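(* Let $G$ be a clean 2-dd all of whose alternating cycles have exactly 6 arcs, and suppose $G$ is odd, connected and not 2-splittable. Let $F$ be a subgraph of $G$ with exactly 2 alternating cycles and exactly $s$ saturated vertices. If $s>2$, then we can either collapse $F$ entirely or replace $F$ with a single alternating cycle, so as to obtain an odd 2-dd $G'$, all of whose alternating cycles have exactly 6 arcs, which is H-equivalent to $G$.
   Context: A 2-digraph is a finite digraph in which each vertex has (in-degree, out-degree) equal to $(0,2)$ (an entry vertex), $(2,0)$ (an exit vertex) or $(2,2)$ (a saturated vertex). A 2-dd is a 2-digraph all of whose vertices are saturated. Connected means that the underlying undirected graph is connected. An alternating cycle (AC) is a sequence of $2r$ distinct arcs $(e_0,\dots,e_{2r-1})$ such that $e_i$ and $e_{i+1}$ (indices mod $2r$) have a common end-vertex if $i$ is even and a common start-vertex if $i$ is odd; its forward arcs are the $e_i$ with $i$ even and its backward arcs those with $i$ odd. The arc set of a 2-digraph is uniquely partitioned into ACs. An AC is clean if no vertex is both the start-vertex of one of its arcs and the end-vertex of one of its arcs; a 2-digraph is clean if all its ACs are clean. A subgraph of a 2-dd $G$ means the 2-digraph induced by a non-empty set $K$ of ACs of $G$ (all arcs of these ACs and their end-points). Entry, exit and saturated vertices of a subgraph $F$ are with respect to degrees in $F$. The complement $\overline{F}$ is the subgraph induced by the remaining ACs; the entry vertices of $F$ are exactly the exit vertices of $\overline{F}$ and vice versa. A factor of a 2-digraph is a spanning subgraph which, for every AC, contains either all its forward arcs and none of its backward arcs, or vice versa; it is a disjoint union of directed cycles and directed paths from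 entry to exit vertices. A factor is open if it contains no cycle. The route of a factor is the bijection from entry vertices to exit vertices sending each entry vertex to the end of the path starting there; a route is open if it is the route of at least one open factor. A 2-dd is odd if every one of its factors has an odd number of cycles. It is Hamiltonian if it has a directed cycle through all vertices. Two 2-dds are H-equivalent if both are Hamiltonian or both are non-Hamiltonian. Splitting a saturated vertex $v$ means replacing it by two vertices $v^{in},v^{out}$, the two in-arcs of $v$ becoming in-arcs of $v^{in}$ and the two out-arcs becoming out-arcs of $v^{out}$. $G$ is 2-splittable if there is a set of 2 saturated vertices such that splitting both increases the number of connected components. Collapsing $F$ (when $F$ has a unique open route $r$): replace $G$ by the 2-dd formed from $\overline{F}$ by identifying each entry vertex $u$ of $F$ with the exit vertex $r(u)$ of $F$ (the arcs and saturated vertices of $F$ are deleted); this is the unique minor in the quotient of $G$ by $F$. Replacing $F$ by a 2-digraph $F'$ with the same number of exit vertices as $F$: form a 2-dd from the disjoint union of $\overline{F}$ and $F'$ by identifying the exit vertices of $\overline{F}$ with the entry vertices of $F'$ via some bijection and the exit vertices of $F'$ with the entry vertices of $\overline{F}$ via some bijection. *)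

(* Defs.v *)
From mathcomp Require Import all_boot.

Set Implicit Arguments.
Unset Strict Implicit.
Unset Printing Implicit Defensive.

(* Finite digraphs with a type of arcs: loops and parallel arcs are allowed,
   since identifying vertices may create them. *)
Record digraph := Digraph {
  vert : finType;
  darc : finType;
  src : darc -> vert;
  tgt : darc -> vert
}.

Definition indeg (G : digraph) (v : vert G) : nat := #|[set e : darc G | tgt e == v]|.
Definition outdeg (G : digraph) (v : vert G) : nat := #|[set e : darc G | src e == v]|.

Definition is_entry (G : digraph) (v : vert G) : bool :=
  (indeg v == 0) && (outdeg v == 2).
Definition is_exit (G : digraph) (v : vert G) : bool :=
  (indeg v == 2) && (outdeg v == 0).
Definition is_saturated (G : digraph) (v : vert G) : bool :=
  (indeg v == 2) && (outdeg v == 2).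

Definition is_2digraph (G : digraph) : Prop :=
  forall v : vert G, [|| is_entry v, is_exit v | is_saturated v].
Definition is_2dd (G : digraph) : Prop := forall v : vert G, is_saturated v.

Definition entry (G : digraph) : finType := {v : vert G | is_entry v}.
Definition exit (G : digraph) : finType := {v : vert G | is_exit v}.

(* The underlying undirected graph. *)
Definition uadj (G : digraph) : rel (vert G) := fun x y =>
  [exists e : darc G, ((src e == x) && (tgt e == y)) || ((src e == y) && (tgt e == x))].

Definition connected (G : digraph) : Prop := forall x y : vert G, connect (@uadj G) x y.

Definition num_components (G : digraph) : nat := n_comp (@uadj G) (vert G).

(* Here ordS is the successor modulo n; the forward arcs are the tnth t i with
   i even and the backward arcs those with i odd. *)
Definition alt_cycle (G : digraph) (n : nat) (t : n.-tuple (darc G)) : bool :=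
  [&& 0 < n, ~~ odd n, uniq t &
      [forall i : 'I_n, if odd i then src (tnth t i) == src (tnth t (ordS i))
                        else tgt (tnth t i) == tgt (tnth t (ordS i))]].

(* Sequences differing by rotation or reversal describe the same alternating
   cycle, so alternating cycles are counted through their arc sets. *)
Definition ACs (G : digraph) : {set {set darc G}} :=
  [set A : {set darc G} |
    [exists t : #|A|.-tuple (darc G), alt_cycle t && (A == [set e in t])]].

Definition clean (G : digraph) : Prop :=
  forall A : {set darc G}, A \in ACs G ->
    forall e e' : darc G, e \in A -> e' \in A -> src e <> tgt e'.

Definition all_ACs_size6 (G : digraph) : Prop :=
  forall A : {set darc G}, A \in ACs G -> #|A| = 6.

(* A factor is a spanning subgraph, hence given by its arc set. *)
Definition is_factor (G : digraph) (f : {set darc G}) : Prop :=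
  forall (n : nat) (t : n.-tuple (darc G)), alt_cycle t ->
    (forall i : 'I_n, (tnth t i \in f) = ~~ odd i) \/
    (forall i : 'I_n, (tnth t i \in f) = odd i).

(* A one-arc sequence is a directed cycle exactly when the arc is a loop. *)
Definition dicycle (G : digraph) (c : seq (darc G)) : bool :=
  [&& c != [::], uniq (map (@src G) c) & cycle (fun e e' => tgt e == src e') c].

Definition is_dicycle_set (G : digraph) (C : {set darc G}) : bool :=
  [exists c : #|C|.-tuple (darc G), dicycle c && (C == [set e in c])].

Definition num_cycles (G : digraph) (f : {set darc G}) : nat :=
  #|[set C : {set darc G} | is_dicycle_set C && (C \subset f)]|.

Definition odd_2dd (G : digraph) : Prop :=
  is_2dd G /\ forall f : {set darc G}, is_factor f -> odd (num_cycles f).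

Definition hamiltonian (G : digraph) : Prop :=
  exists c : seq (darc G), dicycle c /\ forall v : vert G, v \in map (@src G) c.

Definition H_equivalent (G H : digraph) : Prop := hamiltonian G <-> hamiltonian H.

Definition is_open (G : digraph) (f : {set darc G}) : Prop := num_cycles f = 0.

Definition step (G : digraph) (f : {set darc G}) : rel (vert G) := fun x y =>
  [exists e in f, (src e == x) && (tgt e == y)].

(* In a factor every vertex has out-degree at most one, so the exit vertex
   reached from a given entry vertex is unique. *)
Definition is_route (G : digraph) (f : {set darc G}) (r : {ffun entry G -> exit G}) : Prop :=
  forall u : entry G, connect (step f) (val u) (val (r u)).

Definition open_route (G : digraph) (r : {ffun entry G -> exit G}) : Prop :=
  exists f : {set darc G}, [/\ is_factor f, is_open f & is_route f r].

Definition unique_open_route (G : digraph) (r : {ffun entry G -> exit G}) : Prop :=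
  open_route r /\ forall r' : {ffun entry G -> exit G}, open_route r' -> r' = r.

(* Splitting the vertices of S: inr v is v^in, and for v in S inl v is v^out. *)
Definition split_vertices (G : digraph) (S : {set vert G}) : digraph :=
  @Digraph (vert G + {v : vert G | v \in S})%type (darc G)
    (fun e => inl (src e))
    (fun e => if insub (tgt e) is Some w then inr w else inl (tgt e)).

Definition two_splittable (G : digraph) : Prop :=
  exists S : {set vert G},
    [/\ #|S| = 2, forall v, v \in S -> is_saturated v
      & num_components G < num_components (split_vertices S)].

Definition endpoints (G : digraph) (A : {set darc G}) : {set vert G} :=
  [set v | [exists e in A, (src e == v) || (tgt e == v)]].

Lemma src_endpoints (G : digraph) (A : {set darc G}) (e : {e : darc G | e \in A}) :
  src (val e) \in endpoints A.
Proof. by rewrite inE; apply/existsP; exists (val e); rewrite (valP e) eqxx. Qed.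

Lemma tgt_endpoints (G : digraph) (A : {set darc G}) (e : {e : darc G | e \in A}) :
  tgt (val e) \in endpoints A.
Proof. by rewrite inE; apply/existsP; exists (val e); rewrite (valP e) eqxx orbT. Qed.

Definition arc_induced (G : digraph) (A : {set darc G}) : digraph :=
  @Digraph {v : vert G | v \in endpoints A} {e : darc G | e \in A}
    (fun e => Sub (src (val e)) (src_endpoints e))
    (fun e => Sub (tgt (val e)) (tgt_endpoints e)).

Definition subgraph (G : digraph) (K : {set {set darc G}}) : digraph :=
  arc_induced (cover K).

Definition complement (G : digraph) (K : {set {set darc G}}) : digraph :=
  subgraph (ACs G :\: K).

(* Identification of the vertices related by E: the quotient by the generated
   equivalence relation, each class being represented by its root. *)
Definition symc (T : finType) (E : rel T) : rel T := fun x y => E x y || E y x.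

Lemma symc_connect_sym (T : finType) (E : rel T) : connect_sym (symc E).
Proof. by apply: sym_connect_sym => x y; rewrite /symc orbC. Qed.

Definition glue (H : digraph) (E : rel (vert H)) : digraph :=
  @Digraph {x : vert H | roots (symc E) x} (darc H)
    (fun e => Sub (root (symc E) (src e)) (roots_root (symc_connect_sym E) (src e)))
    (fun e => Sub (root (symc E) (tgt e)) (roots_root (symc_connect_sym E) (tgt e))).

(* Vertices of the subgraph and of its complement are compared in G. *)
Definition collapse (G : digraph) (K : {set {set darc G}})
    (r : {ffun entry (subgraph K) -> exit (subgraph K)}) : digraph :=
  @glue (complement K) (fun x y =>
    [exists u : entry (subgraph K),
      (val x == val (val u)) && (val y == val (val (r u)))]).

Definition disjoint_union (H H' : digraph) : digraph :=
  @Digraph (vert H + vert H')%type (darc H + darc H')%type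
    (fun e => match e with inl a => inl (src a) | inr a => inr (src a) end)
    (fun e => match e with inl a => inl (tgt a) | inr a => inr (tgt a) end).

Definition replace (G : digraph) (K : {set {set darc G}}) (F' : digraph)
    (phi : exit (complement K) -> entry F') (psi : exit F' -> entry (complement K)) :
    digraph :=
  @glue (disjoint_union (complement K) F') (fun x y =>
    [exists u, (x == inl (val u)) && (y == inr (val (phi u)))] ||
    [exists w, (x == inr (val w)) && (y == inl (val (psi w)))]).

Definition single_AC (F' : digraph) : Prop := is_2digraph F' /\ #|ACs F'| = 1.

(* Main.v *)
(** In a 2-dd a factor is the same as the graph of a permutation of the vertices, and
    its cycles are the cycles of this permutation. Let X and Y be the sets of start
    and end vertices of the arcs of F. As G is clean with 6-arc alternating cycles,
    |X| = |Y| = 6; the entry vertices of F form X \ Y, its exit vertices Y \ X, and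
    s = |X \cap Y|.
    - If s = 5, splitting the entry and the exit vertex of F disconnects G.
    - If s = 6, then F = G by connectedness. Switching one alternating cycle of a
      factor yields two factors whose odd numbers of cycles are at most 3 and cannot
      both be 3, so G is Hamiltonian, and it is replaced by the 2-dd formed by a
      single alternating cycle on three vertices, all factors of which are Hamiltonian.
    - If s is 3 or 4, a finite check over all ways of gluing two hexagons provides an
      open factor of F. Two open routes never differ by a transposition: completed by
      one factor of the complement they would give factors of G whose numbers of
      cycles differ in parity. A unique open route, in particular if s = 4, allows
      collapsing, which preserves the number of cycles of each factor that is open
      on F. If s = 3 and r1, r2 are distinct open routes, they differ at each of the
      three entries, hence are the routes of a single alternating cycle F'. When a
      Hamiltonian cycle of G uses a third open route of F, exchanging it for r1 or r2
      gives two factors with 1 or 3 cycles; 3 cycles would determine the route, so one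
      of the two is Hamiltonian. *)

From mathcomp Require Import all_boot fingroup perm zify.
Require Import Defs.
Set Implicit Arguments.
Unset Strict Implicit.
Unset Printing Implicit Defensive.

(** * Orbits and return maps *)

(** The maps need not be inverse to each other: it suffices that both preserve connectedness and
    that each round trip stays in its component. This compares the cycles of a factor before and
    after vertices are identified or removed. *)
Lemma n_comp_equiv (T T' : finType) (e : rel T) (e' : rel T')
    (phi : T' -> T) (psi : T -> T') :
  connect_sym e -> connect_sym e' ->
  (forall x y, e x y -> connect e' (psi x) (psi y)) ->
  (forall x' y', e' x' y' -> connect e (phi x') (phi y')) ->
  (forall x, connect e x (phi (psi x))) ->
  (forall x', connect e' x' (psi (phi x'))) ->
  n_comp e T = n_comp e' T'.
Proof.
move=> sym sym' psiP phiP phipsi psiphi.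
have lift (U W : finType) (d : rel U) (d' : rel W) (h : U -> W) :
    (forall x y, d x y -> connect d' (h x) (h y)) ->
    forall x y, connect d x y -> connect d' (h x) (h y).
  move=> hP x y /connectP[p + ->]; elim: p x => //= z p IHp x /andP[xz zp].
  exact: connect_trans (hP _ _ xz) (IHp _ zp).
rewrite (@adjunction_n_comp _ _ phi e e') //.
split=> [x _ | x' y' _]; first by exists (psi x).
apply/idP/idP; first exact: lift phiP _ _.
move=> /(lift _ _ _ _ _ psiP) xy; apply: connect_trans (psiphi x') _.
by apply: connect_trans xy _; rewrite sym'.
Qed.

(** Connects counting by [fcard] with the permutation library, where multiplication by a
    transposition is known to change the number of orbits by one. *)
Lemma card_porbits (T : finType) (s : {perm T}) : #|porbits s| = fcard s T.
Proof.
have sE x y : (y \in porbit s x) = fconnect s x y.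
  apply/porbitP/idP => [[i ->] | /iter_findex <-].
    by rewrite permX fconnect_iter.
  by exists (findex s x y); rewrite permX.
have sym : connect_sym (frel s) by apply/fconnect_sym/perm_inj.
rewrite /porbits -[RHS](@card_in_imset _ _ (porbit s)).
  apply: eq_card => C; apply/imsetP/imsetP => [[x _ ->] | [x _ ->]]; last by exists x.
  exists (froot s x); first by rewrite inE /= (roots_root sym).
  by apply/eqP; rewrite eq_porbit_mem sE sym connect_root.
move=> x y; rewrite !inE !andbT /= => /eqP rx /eqP ry /eqP.
by rewrite eq_porbit_mem sE sym -(root_connect sym) rx ry => /eqP.
Qed.

Section Leave.
Variables (T : finType) (X : {set T}).
Implicit Types (p : T -> T) (x y : T) (k n : nat).

(** The recursion runs on the fuel [k]. Fuel [#|T|] is enough, since a point reachable under [p] is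
    reached in fewer than [#|T|] steps. *)
Fixpoint leave_rec p k x :=
  if k is k'.+1 then if x \in X then leave_rec p k' (p x) else x else x.

(* The first iterate of x under p outside X, a junk value if there is none. *)
Definition leave p x := leave_rec p #|T| x.

(** For injective [p]: no cycle of [p] lies inside [X]. With [X] the start vertices of the arcs of a
    subgraph, this expresses that a factor is open there ([restr_open]). *)
Definition leaves p := forall x, exists n, iter n p x \notin X.

Lemma leave_out p x : x \notin X -> leave p x = x.
Proof. by rewrite /leave; case: #|T| => //= k /negPf->. Qed.

Lemma leave_recE p k x n : n <= k -> iter n p x \notin X ->
  exists m, [/\ m <= n, leave_rec p k x = iter m p x, iter m p x \notin X
              & forall i, i < m -> iter i p x \in X].
Proof.
elim: k x n => [|k IHk] x n; first by rewrite leqn0 => /eqP-> xX; exists 0.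
case: n => [_ /= xX | n le_nk nX]; first by exists 0; rewrite (negPf xX).
have [xX | xX] := boolP (x \in X); last by exists 0; rewrite /= (negPf xX).
move: nX; rewrite iterSr => /(IHk (p x) n le_nk)[m [le_mn mE mX mP]].
exists m.+1; rewrite /= xX -iterS iterSr; split=> // i.
by case: i => // i lt_im; rewrite iterSr; apply: mP.
Qed.

Lemma leaveP p x : leaves p ->
  exists m, [/\ leave p x = iter m p x, iter m p x \notin X
              & forall i, i < m -> iter i p x \in X].
Proof.
move=> /(_ x)[n nX]; set y := iter n p x in nX.
have xy : fconnect p x y by apply: fconnect_iter.
have lt_n : findex p x y <= #|T|.
  by apply: ltnW; apply: leq_trans (findex_max xy) (max_card _).
have := @leave_recE p #|T| x (findex p x y) lt_n.
by rewrite iter_findex // => /(_ nX)[m [_ ? ? ?]]; exists m.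
Qed.

Lemma leave_notin p x : leaves p -> leave p x \notin X.
Proof. by move=> /(leaveP x)[m [->]]. Qed.

Lemma leave_fconnect p x : leaves p -> fconnect p x (leave p x).
Proof. by move=> /(leaveP x)[m [-> _ _]]; apply: fconnect_iter. Qed.

Lemma leave_step p x : leaves p -> x \in X -> leave p x = leave p (p x).
Proof.
move=> lp xX; have [m [-> mX mP]] := leaveP x lp.
have [n [-> nX nP]] := leaveP (p x) lp; rewrite -iterSr.
case: m mX mP => [|m mX mP]; first by rewrite /= xX.
move: nX nP; rewrite -iterSr => nX nP.
case: (ltngtP m n) => [lt_mn | lt_nm | -> //].
  by have := nP _ lt_mn; rewrite -iterSr (negPf mX).
by have := mP n.+1 lt_nm; rewrite (negPf nX).
Qed.

Lemma leave_eq p q : leaves p -> {in X, p =1 q} ->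
  leaves q /\ leave p =1 leave q.
Proof.
move=> lp pq.
have lq : leaves q.
  move=> x; have [m [_ mX mP]] := leaveP x lp; exists m.
  suff -> : iter m q x = iter m p x by [].
  have: m <= m by []; elim: {-2}m => //= i IHi lt_im.
  by rewrite IHi 1?ltnW // -pq // mP.
split=> // x; have [m [-> mX mP]] := leaveP x lp.
elim: m x mX mP => [|m IHm] x mX mP; first by rewrite leave_out.
have xX := mP 0 isT; rewrite leave_step // -pq // iterSr; apply: IHm.
  by rewrite -iterSr.
by move=> i lt_im; rewrite -iterSr; apply: mP.
Qed.

(** Trace back from the common exit: by injectivity one of the two points is an iterate of the
    other. If they differed, the predecessor of the later one would lie in [X], putting that point
    in [p @: X]. *)
Lemma leave_inj p : injective p -> leaves p ->
  {in [predC p @: X] &, injective (leave p)}.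
Proof.
move=> injp lp x y; have [m [-> mX mP]] := leaveP x lp.
have [n [-> nX nP]] := leaveP y lp.
wlog le_mn : x y m n mX mP nX nP / m <= n => [IH|].
  by case/orP: (leq_total m n) => le xY yY e; [|symmetry]; apply: IH le _ _ _.
rewrite -{1}(subnKC le_mn) iterD => xY yY e0.
have injm i : injective (iter i p) by elim: i => //= i IHi u v /injp/IHi.
have {e0} e := injm _ _ _ e0.
case E: (n - m) e => [|k] // e; case/negP: xY; rewrite e /=.
by apply/imset_f/nP; rewrite -ltnS -E ltnS leq_subr.
Qed.

Lemma leave_in p x : leaves p -> x \in X -> leave p x \in p @: X.
Proof.
move=> lp xX; have [m [-> mX mP]] := leaveP x lp.
case: m mX mP => [|m mX mP]; first by rewrite /= xX.
by rewrite /=; apply: imset_f; apply: mP.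
Qed.

(** Inclusion and injectivity suffice, because [X] and [p @: X] have the same size and so do their
    two differences. *)
Lemma leave_onto p : injective p -> leaves p ->
  leave p @: (X :\: p @: X) = p @: X :\: X.
Proof.
move=> injp lp; apply/eqP; rewrite eqEcard; apply/andP; split.
  apply/subsetP => y /imsetP[x]; rewrite inE => /andP[_ xX] ->.
  by rewrite inE leave_notin //= leave_in.
rewrite card_in_imset; last first.
  by move=> x y; rewrite !in_setD => /andP[xY _] /andP[yY _]; apply: leave_inj.
rewrite !cardsD card_imset // (_ : X :&: _ = p @: X :&: X) //; exact: setIC.
Qed.

Section Return.
Variables (p : T -> T) (injp : injective p) (lp : leaves p).

(** This is the first-return map of [p] on the complement of [X]. *)
Definition return_fun (v : {v | v \notin X}) : {v | v \notin X} :=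
  Sub (leave p (p (val v))) (leave_notin _ lp).

Lemma return_inj : injective return_fun.
Proof.
move=> u v /(congr1 val) /= /leave_inj e; apply/val_inj/injp/e => //.
  by rewrite inE /= mem_imset //; apply: (valP u).
by rewrite inE /= mem_imset //; apply: (valP v).
Qed.

(** Every cycle of [p] meets the complement of [X]; cutting out its visits to [X] leaves exactly one
    cycle of the return map. *)
Lemma fcard_return : fcard p T = fcard return_fun {: {v | v \notin X}}.
Proof.
have sym : connect_sym (frel p) by apply: fconnect_sym.
apply: (@n_comp_equiv _ _ _ _ val (fun v => Sub (leave p v) (leave_notin _ lp))) => //.
- by apply/fconnect_sym/return_inj.
- move=> x y /eqP<-; have [xX | xX] := boolP (x \in X).
    rewrite -(_ : Sub (leave p x) (leave_notin x lp) = Sub _ _) //.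
    by apply: val_inj; rewrite /= leave_step.
  apply: connect1; apply/eqP/val_inj => /=; by rewrite (leave_out _ xX).
- move=> u v /eqP<- /=; apply: connect_trans (fconnect1 _ _) _.
  exact: leave_fconnect.
- by move=> x; apply: leave_fconnect.
- by move=> v; rewrite (_ : Sub _ _ = v) //; apply: val_inj; rewrite /= leave_out // (valP v).
Qed.

End Return.

Arguments return_inj {p} injp lp [x1 x2].
Arguments fcard_return {p} injp lp.

(* The return maps of p and q to the complement of X differ by a transposition. *)
Lemma odd_fcard_swap p q x y :
  injective p -> injective q -> leaves p -> leaves q ->
  {in [predC X], p =1 q} ->
  x \notin p @: X -> y \notin p @: X -> x != y ->
  {in [predC p @: X], forall v, leave q v = leave p (tperm x y v)} ->
  odd (fcard q T) = ~~ odd (fcard p T).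
Proof.
move=> injp injq lp lq pq xY yY neq_xy swap.
have preX z : z \notin p @: X -> finv p z \notin X.
  by apply: contra => zX; rewrite -(f_finv injp z) imset_f.
(* The predecessors of [x] and [y] under [p] lie outside [X]; they are the points at which the two
   return maps differ. *)
pose x0 : {v | v \notin X} := Sub (finv p x) (preX _ xY).
pose y0 : {v | v \notin X} := Sub (finv p y) (preX _ yY).
pose rp := perm (return_inj injp lp); pose rq := perm (return_inj injq lq).
have fcE (U : finType) (f : U -> U) (injf : injective f) :
    fcard f U = #|porbits (perm injf)|.
  rewrite card_porbits; apply: eq_n_comp; apply: eq_connect => u v /=.
  by rewrite permE.
rewrite (fcard_return injp lp) (fcard_return injq lq).
rewrite (fcE _ _ (return_inj injp lp)) (fcE _ _ (return_inj injq lq)) -/rp -/rq.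
have nxy0 : x0 != y0.
  apply: contra neq_xy => /eqP/(congr1 val)/= /(congr1 p).
  by rewrite !f_finv // => ->.
(* In this product the transposition acts first. One transposition changes the number of cycles by
   one, hence its parity. *)
have -> : rq = (tperm x0 y0 * rp)%g.
  apply/permP => v; rewrite permM [LHS]permE [RHS]permE; apply: val_inj => /=.
  have vX : val v \notin X := valP v.
  rewrite -pq // swap; last by rewrite inE /= mem_imset.
  rewrite -{1}[x](f_finv injp) -{1}[y](f_finv injp).
  by rewrite (inj_tperm _ _ _ val_inj) (inj_tperm _ _ _ injp).
have := porbits_mul_tperm rp x0 y0; rewrite nxy0 /= addn1.
by move=> /(congr1 odd); rewrite oddD odd_double addbF /=.
Qed.

End Leave.

Lemma fcard1P (T : finType) (p : T -> T) : injective p ->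
  fcard p T = 1 <-> (exists x : T, true) /\ forall x y, fconnect p x y.
Proof.
move=> injp; have clT : fclosed p T by [].
split=> [p1 | [[x _] pP]].
  split=> [|x y].
    have p0 : 0 < fcard p T by rewrite p1.
    by have [x _] := fcard_gt0P injp clT p0; exists x.
  apply: contraPT (p1) => nxy; have: 1 < fcard p T.
    by apply/(fcard_gt1P injp clT); exists x => //; exists y.
  by case: (fcard p T) => [|[]].
have sym := fconnect_sym injp; rewrite -(n_comp_connect sym x).
by apply: eq_n_comp_r => y; rewrite !inE pP.
Qed.

(** All cycles meet [Z], so there are at most three of them, and by parity one or three. Three
    cycles leave only one point of [Z] for each. *)
Lemma fcard_meet3 (T : finType) (p : T -> T) (Z : {set T}) :
  injective p -> #|Z| = 3 -> (forall x, exists2 z, z \in Z & fconnect p x z) ->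
  odd (fcard p T) -> fcard p T = 1 \/ {in Z &, forall x y, fconnect p x y -> x = y}.
Proof.
move=> injp Z3 meetZ; have sym := fconnect_sym injp.
have -> : fcard p T = #|froot p @: Z|.
  apply: eq_card => r; rewrite !inE andbT; apply/idP/imsetP.
    move=> /eqP rE; have [z zZ rz] := meetZ r; exists z => //.
    by rewrite -rE; apply/eqP; rewrite root_connect.
  by case=> z _ ->; apply: roots_root.
have: #|froot p @: Z| <= 3 by rewrite -Z3 leq_imset_card.
case E: #|_| => [|[|[|[|]]]] //; [by left | right].
have /imset_injP injr : #|froot p @: Z| == #|Z| by rewrite E Z3.
by move=> x y xZ yZ xy; apply: injr => //; apply/eqP; rewrite root_connect.
Qed.

(** * Alternating cycles and factors *)

Section Mate.
Variables (E : finType) (V : eqType) (h : E -> V).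
Hypothesis h2 : forall e, #|[set e' | h e' == h e]| = 2.

(** The other element of the two-element fibre of [h] through [e]; by [h2] the default value is
    never taken. *)
Definition mate e := odflt e [pick e' | (e' != e) && (h e' == h e)].

Lemma mateP e : mate e != e /\ h (mate e) = h e.
Proof.
rewrite /mate; case: pickP => [e' /andP[? /eqP //] | none] /=.
have: [set e' | h e' == h e] \subset [set e].
  apply/subsetP => e'; rewrite !inE => he; apply: contraFT (none e') => ne.
  by rewrite /= ne he.
by move=> /subset_leq_card; rewrite h2 cards1.
Qed.

Lemma mate_uniq e e' : e' != e -> h e' = h e -> e' = mate e.
Proof.
move=> ne he; apply: contraTeq isT => ne'; have [nm hm] := mateP e.
have: [set e; e'; mate e] \subset [set e' | h e' == h e].
  by apply/subsetP => x; rewrite !inE => /orP[/orP[]|] /eqP->; rewrite ?he ?hm.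
move=> /subset_leq_card; rewrite h2 -setUA cardsU1 cards2 !inE ne'.
by rewrite negb_or eq_sym ne eq_sym nm.
Qed.

Lemma mate_eq e e1 e2 : e != e1 -> e != e2 -> h e = h e1 -> h e = h e2 -> e1 = e2.
Proof.
move=> n1 n2 h1 h2'; rewrite (@mate_uniq e e1) 1?eq_sym //.
by rewrite -(@mate_uniq e e2) 1?eq_sym.
Qed.

Lemma mateK : involutive mate.
Proof.
by move=> e; have [ne he] := mateP e; rewrite -(mate_uniq (e' := e)) // eq_sym.
Qed.

End Mate.

Section Dihedral.
Variables (E : finType) (a b : E -> E).
Hypotheses (aK : involutive a) (bK : involutive b).
Hypotheses (a_free : forall e, a e != e) (b_free : forall e, b e != e).
Let c e := a (b e).

Lemma dihedral_inj : injective c.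
Proof. exact: inj_comp (inv_inj aK) (inv_inj bK). Qed.

(** In the dihedral group generated by [a] and [b], the word [b c^k] is a reflection: conjugation by
    [c] lowers [k] by two, down to [b] or to a conjugate of [a], both without fixed points. *)
Lemma reflection_free k x : b (iter k c x) != x.
Proof.
elim/ltn_ind: k x => -[|[|k]] IHk x; first exact: b_free.
  apply: contra (a_free (b x)) => /eqP e; apply/eqP.
  by rewrite -[in RHS]e bK.
rewrite iterSr iterS {1}/c; apply: contra (IHk k (leqnSn _) (c x)) => /eqP e.
by apply/eqP; rewrite -{2}e /c bK aK.
Qed.

(** So a rotation orbit is disjoint from its mirror image. For arcs these two orbits are the forward
    and the backward arcs of an alternating cycle. *)
Lemma reflection_orbit x y : fconnect c x y -> ~~ fconnect c x (b y).
Proof.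
move=> xy; apply/negP => xby.
have: fconnect c y (b y).
  by apply: connect_trans xby; rewrite fconnect_sym //; apply: dihedral_inj.
move=> /iter_findex e; case/negP: (reflection_free (findex c y (b y)) y).
by rewrite e bK.
Qed.

End Dihedral.

Section Siblings.
Variable H : digraph.
Implicit Types (e : darc H) (f : {set darc H}).

(* Consecutive arcs of an alternating cycle; in a 2-digraph the alternating cycles
   are the connected components ac_of e of this relation. *)
Definition sib : rel (darc H) := fun e e' =>
  (e != e') && ((src e == src e') || (tgt e == tgt e')).

Definition ac_of e := [set e' | connect sib e e'].

(** In a 2-digraph this is equivalent to [is_factor] ([local_factor], [factor_local]), but it does
    not refer to any listing of an alternating cycle. *)
Definition local f := forall e e', sib e e' -> (e \in f) = (e' \notin f).

Lemma sib_sym : symmetric sib.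
Proof. by move=> e e'; rewrite /sib eq_sym (eq_sym (src e)) (eq_sym (tgt e)). Qed.

Lemma sib_connect_sym : connect_sym sib.
Proof. exact/sym_connect_sym/sib_sym. Qed.

(** Membership alternates along a chain of siblings, so one arc determines a factor on its whole
    alternating cycle. *)
Lemma local_agree f g e e' : local f -> local g -> connect sib e e' ->
  (e \in f) = (e \in g) -> (e' \in f) = (e' \in g).
Proof.
move=> lf lg /connectP[p + ->]; elim: p e => //= x p IHp e /andP[ex xp] efg.
by apply: IHp => //; apply: negb_inj; rewrite -(lf _ _ ex) -(lg _ _ ex).
Qed.

Lemma odd_ordS n (i : 'I_n) : ~~ odd n -> odd (ordS i) = ~~ odd i.
Proof.
move=> on /=; case: (ltngtP i.+1 n) (ltn_ord i) => // [lt_in _ | e _].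
  by rewrite modn_small.
have <- : odd n = ~~ odd i by rewrite -[in LHS]e.
by rewrite e modnn /= (negbTE on).
Qed.

Lemma alt_next n (t : n.-tuple (darc H)) i : alt_cycle t ->
  [/\ sib (tnth t i) (tnth t (ordS i)), odd (ordS i) = ~~ odd i
    & if odd i then src (tnth t i) = src (tnth t (ordS i))
      else tgt (tnth t i) = tgt (tnth t (ordS i))].
Proof.
case/and4P => n0 on ut /forallP/(_ i) ti; split; first 1 last.
- exact: odd_ordS.
- by move: ti; case: ifP => _ /eqP.
apply/andP; split; last by move: ti; case: ifP => _ ->; rewrite ?orbT.
rewrite (inj_eq (tuple_uniqP _ ut)); apply: contraTneq isT => e.
by have := odd_ordS i on; rewrite -e; case: odd.
Qed.

Lemma alt_prev n (t : n.-tuple (darc H)) (i : 'I_n) : alt_cycle t ->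
  exists j : 'I_n, i = ordS j /\ odd j = ~~ odd i.
Proof.
move=> /and4P[_ on _ _]; exists (ord_pred i); rewrite ord_predK; split=> //.
by rewrite -[in RHS](ord_predK i) odd_ordS // negbK.
Qed.

Lemma alt_connect n (t : n.-tuple (darc H)) i j : alt_cycle t ->
  connect sib (tnth t i) (tnth t j).
Proof.
move=> at_; have step0 (k : nat) (lt_k : k < n) (lt_0 : 0 < n) :
    connect sib (tnth t (Ordinal lt_0)) (tnth t (Ordinal lt_k)).
  elim: k lt_k => [|k IHk] lt_k; first by rewrite (bool_irrelevance lt_k lt_0).
  apply: connect_trans (IHk (ltnW lt_k)) _.
  have [s _ _] := alt_next (Ordinal (ltnW lt_k)) at_; apply: connect1.
  rewrite (_ : Ordinal lt_k = ordS (Ordinal (ltnW lt_k))) //.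
  by apply: val_inj; rewrite /= modn_small.
have n0 : 0 < n by case: n i {j t at_ step0} => [[]|].
have stepi k : connect sib (tnth t (Ordinal n0)) (tnth t k).
  by case: k => k lt_k; apply: step0.
by apply: connect_trans (stepi j); rewrite sib_connect_sym.
Qed.

Lemma local_alt f n (t : n.-tuple (darc H)) : alt_cycle t -> local f ->
  (forall i, (tnth t i \in f) = ~~ odd i) \/ (forall i, (tnth t i \in f) = odd i).
Proof.
move=> at_ lf; have n0 : 0 < n by case/and4P: at_.
pose i0 := Ordinal n0.
have E (k : nat) (lt_k : k < n) :
    (tnth t (Ordinal lt_k) \in f) = odd k (+) (tnth t i0 \in f).
  elim: k lt_k => [|k IHk] lt_k; first by rewrite /i0 (bool_irrelevance lt_k n0).
  have [s _ _] := alt_next (Ordinal (ltnW lt_k)) at_.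
  rewrite (_ : Ordinal lt_k = ordS (Ordinal (ltnW lt_k))); last first.
    by apply: val_inj; rewrite /= modn_small.
  by apply: negb_inj; rewrite -(lf _ _ s) IHk /= addNb negbK.
by case i0f: (tnth t i0 \in f) E => E; [left|right] => -[k lt_k];
  rewrite E /= ?addbT ?addbF.
Qed.

Lemma local_factor f : local f -> is_factor f.
Proof. by move=> lf n t at_; apply: local_alt. Qed.

End Siblings.

Arguments sib {H} e e'.

Section TwoDigraph.
Variable H : digraph.
Hypothesis H2 : is_2digraph H.
Implicit Types (e : darc H) (f : {set darc H}).

Lemma src_fiber e : #|[set e' | src e' == src e]| = 2.
Proof.
have: 0 < outdeg (src e) by apply/card_gt0P; exists e; rewrite inE.
by rewrite -/(outdeg _); case/or3P: (H2 (src e)) => /andP[_ /eqP->].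
Qed.

Lemma tgt_fiber e : #|[set e' | tgt e' == tgt e]| = 2.
Proof.
have: 0 < indeg (tgt e) by apply/card_gt0P; exists e; rewrite inE.
by rewrite -/(indeg _); case/or3P: (H2 (tgt e)) => /andP[/eqP-> _].
Qed.

Definition smate := mate (@src H).
Definition tmate := mate (@tgt H).

Lemma sibE e e' : sib e e' = (e' == smate e) || (e' == tmate e).
Proof.
have [ns hs] := mateP src_fiber e; have [nt ht] := mateP tgt_fiber e.
apply/andP/orP => [[ne /orP[]/eqP h] | [/eqP-> | /eqP->]].
- by left; apply/eqP; apply: (mate_uniq src_fiber); rewrite // eq_sym.
- by right; apply/eqP; apply: (mate_uniq tgt_fiber); rewrite // eq_sym.
- by rewrite eq_sym ns hs eqxx.
- by rewrite eq_sym nt ht eqxx orbT.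
Qed.

Lemma smateK : involutive smate. Proof. exact: mateK src_fiber. Qed.
Lemma tmateK : involutive tmate. Proof. exact: mateK tgt_fiber. Qed.
Lemma smate_neq e : smate e != e. Proof. by case: (mateP src_fiber e). Qed.
Lemma tmate_neq e : tmate e != e. Proof. by case: (mateP tgt_fiber e). Qed.
Lemma src_smate e : src (smate e) = src e. Proof. by case: (mateP src_fiber e). Qed.
Lemma tgt_tmate e : tgt (tmate e) = tgt e. Proof. by case: (mateP tgt_fiber e). Qed.

(** Advances by two arcs along the alternating cycle and so keeps the kind, forward or backward, of
    an arc. *)
Let rot e := smate (tmate e).

Lemma rot_inj : injective rot. Proof. exact: dihedral_inj smateK tmateK. Qed.

(** The orbit of [e] under [rot] together with its image under [tmate] is closed under both mates,
    hence is the whole component. *)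
Lemma ac_of_rot e x : (x \in ac_of e) = fconnect rot e x || fconnect rot e (tmate x).
Proof.
pose near y := fconnect rot e y \/ fconnect rot e (tmate y).
have near_sib y z : sib y z -> near y -> near z.
  rewrite sibE /near => /orP[]/eqP->; rewrite ?tmateK; last by case; [right | left].
  case=> yE; [right | left].
    rewrite fconnect_sym; last exact: rot_inj.
    rewrite (same_fconnect1 rot_inj) /rot tmateK smateK.
    by rewrite fconnect_sym //; apply: rot_inj.
  by rewrite -[y]tmateK; apply: connect_trans yE (fconnect1 _ _).
rewrite inE; apply/idP/orP => [/connectP[p + ->] | ].
  suff path_near q y : near y -> path sib y q -> near (last y q).
    by apply: path_near; left; apply: connect0.
  by elim: q y => //= z q IHq y yE /andP[/near_sib/(_ yE)]; apply: IHq.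
have sub x' : fconnect rot e x' -> connect sib e x'.
  apply: connect_sub => u v /eqP<-; apply: (@connect_trans _ _ (tmate u)).
    by apply: connect1; rewrite sibE eqxx orbT.
  by apply: connect1; rewrite sibE eqxx.
case=> /sub // ex; apply: connect_trans ex _; apply: connect1.
by rewrite sibE tmateK eqxx orbT.
Qed.

Lemma ac_of_tuple e : exists t : #|ac_of e|.-tuple (darc H),
  alt_cycle t && (ac_of e == [set x in t]).
Proof.
pose r := fingraph.order rot e.
(* The two orbits are interleaved: position [2k] holds the [k]-th rotate of [e], position [2k+1] its
   [tmate]. Thus steps from even positions share the end-vertex and steps from odd positions the
   start-vertex. *)
pose u i := (if odd i then tmate else id) (iter i./2 rot e).
pose s := mkseq u r.*2.
have r0 : 0 < r by apply: fingraph.order_gt0.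
have c_u i : fconnect rot e (iter i rot e) by apply: fconnect_iter.
have nb x : fconnect rot e x -> ~~ fconnect rot e (tmate x).
  exact: (reflection_orbit smateK tmateK smate_neq tmate_neq).
have us : uniq s.
  apply/mkseq_uniqP => i j; rewrite !inE => lt_i lt_j; rewrite /u.
  have inj_rot k l : k < r -> l < r -> iter k rot e = iter l rot e -> k = l.
    move=> lt_k lt_l /eqP; rewrite -[iter k _ _](nth_traject _ lt_k).
    rewrite -[iter l _ _](nth_traject _ lt_l) -/(orbit rot e).
    by rewrite nth_uniq ?size_traject ?orbit_uniq // => /eqP.
  have i2 : i./2 < r by lia.
  have j2 : j./2 < r by lia.
  case oi: (odd i); case oj: (odd j) => h.
  - by move: h => /(can_inj tmateK)/inj_rot; lia.
  - by have := nb _ (c_u i./2); rewrite h c_u.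
  - by have := nb _ (c_u j./2); rewrite -h c_u.
  - by move: h => /inj_rot; lia.
have sE : ac_of e = [set x in s].
  apply/setP => x; rewrite ac_of_rot inE; apply/orP/mapP.
    case=> [h | h].
      exists (findex rot e x).*2; last by rewrite /u odd_double doubleK iter_findex.
      by rewrite mem_iota /= add0n ltn_double findex_max.
    exists (findex rot e (tmate x)).*2.+1.
      rewrite mem_iota /= add0n.
      by have := findex_max h; rewrite -/r; lia.
    by rewrite /u /= odd_double /= uphalf_double iter_findex // tmateK.
  case=> i _ ->; rewrite /u; case: (odd i); last by left.
  by right; rewrite tmateK.
have ns : size s == #|ac_of e| by rewrite sE cardsE (card_uniqP us).
exists (Tuple ns); apply/andP; split; last by rewrite -sE.
have nE : #|ac_of e| = r.*2 by rewrite -(eqP ns) size_mkseq.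
apply/and4P; split=> //; rewrite ?nE ?odd_double ?double_gt0 //.
have uP k : k < r.*2 -> if odd k then src (u k) == src (u (k.+1 %% r.*2))
                        else tgt (u k) == tgt (u (k.+1 %% r.*2)).
  move=> lt_k; have [lt_k1 | ge_k1] := ltnP k.+1 r.*2.
    rewrite (modn_small lt_k1) /u /=; case ok: (odd k) => /=.
      by rewrite uphalf_half ok /= src_smate.
    by rewrite uphalf_half ok /= tgt_tmate.
  (* At the wrap-around, [r] applications of [rot] lead back to [e]. *)
  have kE : k.+1 = r.*2 by apply/eqP; rewrite eqn_leq ge_k1 lt_k.
  have ok : odd k by lia.
  rewrite kE modnn /u /= ok /=.
  have eE : rot (iter k./2 rot e) = e.
    rewrite -iterS; have -> : k./2.+1 = r by lia.
    exact: iter_order rot_inj _.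
  by rewrite -[X in _ == src X]eE src_smate.
apply/forallP => i; rewrite !(tnth_nth e) /= !nth_mkseq; last 2 first.
- by rewrite -nE (ltn_ord (ordS i)).
- by rewrite -nE.
by case: i => k /=; rewrite nE; apply: uP.
Qed.

(** The two neighbours of an arc in the tuple already exhaust its two fibres of size two, so a
    sibling must be one of these neighbours. *)
Lemma alt_sib n (t : n.-tuple (darc H)) i e : alt_cycle t -> sib (tnth t i) e ->
  exists j, e = tnth t j /\ odd j = ~~ odd i.
Proof.
move=> at_ /andP[ne h].
have [j [ij oj]] := alt_prev i at_.
have [/andP[nn _] on nP] := alt_next i at_.
have := alt_next j at_; rewrite -ij => -[/andP[np _] _ pP].
move: nP pP; rewrite oj; case oi: (odd i) => /= nP pP; case/orP: h => /eqP h.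
- by exists (ordS i); rewrite on oi; split=> //; apply: (mate_eq src_fiber ne nn).
- by exists j; rewrite oj oi; split=> //; apply: (mate_eq tgt_fiber ne); rewrite 1?eq_sym.
- by exists j; rewrite oj oi; split=> //; apply: (mate_eq src_fiber ne); rewrite 1?eq_sym.
- by exists (ordS i); rewrite on oi; split=> //; apply: (mate_eq tgt_fiber ne nn).
Qed.

Lemma ACsP A : reflect (exists e, A = ac_of e) (A \in ACs H).
Proof.
rewrite inE; apply: (iffP existsP) => [[t /andP[at_ /eqP AE]] | [e ->]]; last exact: ac_of_tuple.
have n0 : 0 < #|A| by case/and4P: at_.
have: forall i, connect sib (tnth t (Ordinal n0)) (tnth t i).
  by move=> i; apply: alt_connect.
have: tnth t (Ordinal n0) \in t by apply: mem_tnth.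
move: (tnth t _) => z zt zc; exists z; apply/setP => x.
rewrite [in LHS]AE !inE; apply/idP/idP => [/tnthP[i ->] // | /connectP[p + ->]].
elim: p z {zc} zt => //= y p IHp z /tnthP[i zE] /andP[zy yp]; apply: IHp yp.
by rewrite zE in zy; have [j [-> _]] := alt_sib at_ zy; apply: mem_tnth.
Qed.

Lemma factor_local f : is_factor f -> local f.
Proof.
move=> ff e e' s; have [t /andP[at_ /eqP tE]] := ac_of_tuple e.
have: e \in ac_of e by rewrite inE connect0.
rewrite tE inE => /tnthP[i eE]; rewrite eE in s *.
have [j [-> oj]] := alt_sib at_ s.
by case: (ff _ _ at_) => E; rewrite !E oj ?negbK.
Qed.

(** In each alternating cycle choose the [rot]-orbit of its canonical root; the mirror orbit
    consists of the arcs left out. *)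
Lemma exists_local : exists f, local f.
Proof.
pose r := root (@sib H).
exists [set e | fconnect rot (r e) e] => e e' s; rewrite !inE.
have -> : r e' = r e by apply/esym/eqP; rewrite root_connect ?connect1 //; apply: sib_connect_sym.
have: e \in ac_of (r e) by rewrite inE sib_connect_sym connect_root.
have: e' \in ac_of (r e).
  rewrite inE; apply: connect_trans (connect1 s).
  by rewrite sib_connect_sym connect_root.
have nb x : fconnect rot (r e) x -> ~~ fconnect rot (r e) (tmate x).
  exact: (reflection_orbit smateK tmateK smate_neq tmate_neq).
rewrite !ac_of_rot => e'A eA; move: s; rewrite sibE => /orP[]/eqP e'E.
  have rE x : fconnect rot (r e) (smate x) = fconnect rot (r e) (tmate x).
    apply/idP/idP => h; last by rewrite -[x]tmateK; apply: connect_trans h (fconnect1 _ _).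
    rewrite fconnect_sym; last exact: rot_inj.
    rewrite (same_fconnect1 rot_inj) /rot tmateK.
    by rewrite fconnect_sym //; apply: rot_inj.
  rewrite e'E rE; case/orP: eA => h; first by rewrite h nb.
  by rewrite h; apply/negbTE/negP => /nb; rewrite h.
rewrite e'E; case/orP: eA => h; first by rewrite h nb.
by rewrite h; apply/negbTE/negP => /nb; rewrite h.
Qed.

End TwoDigraph.

(** * Cycles of factors in a 2-dd *)

Section Cycles.
Variable G : digraph.
Implicit Types (v : vert G) (e : darc G) (f : {set darc G}) (c : seq (darc G)).

Lemma dicycle_set c : dicycle c -> is_dicycle_set [set e in c].
Proof.
move=> dc; have uc : uniq c by case/and3P: dc => _ /map_uniq.
have szc : size c == #|[set e in c]| by rewrite cardsE (card_uniqP uc).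
by apply/existsP; exists (Tuple szc); rewrite dc /=.
Qed.

Lemma openP f : is_open f <-> forall c, dicycle c -> ~~ all [in f] c.
Proof.
split=> [f0 c dc | fP].
  apply: contraPN f0 => /allP cf; rewrite /is_open /num_cycles => /eqP.
  rewrite cards_eq0 => /eqP/setP/(_ [set e in c]).
  rewrite !inE dicycle_set // => /negbT/negP; apply.
  by apply/subsetP => e; rewrite inE; apply: cf.
apply/eqP; rewrite /num_cycles cards_eq0; apply/eqP/setP => C; rewrite !inE.
apply/negP => /andP[/existsP[c /andP[dc /eqP CE]] /subsetP Cf].
by case/negP: (fP _ dc); apply/allP => e ec; apply: Cf; rewrite CE inE.
Qed.

(** The successor map of a factor. In a 2-dd every vertex has an outgoing arc in the factor
    ([local_out]), so the default [v] does not occur and the map is a permutation. *)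
Definition nxt f v :=
  if [pick e | (e \in f) && (src e == v)] is Some e then tgt e else v.

Lemma local_src f e e' : local f -> e \in f -> e' \in f -> src e = src e' -> e = e'.
Proof.
move=> lf ef e'f h; apply: contraTeq ef => ne.
by rewrite (lf _ e') ?e'f // /sib ne h eqxx.
Qed.

Lemma local_tgt f e e' : local f -> e \in f -> e' \in f -> tgt e = tgt e' -> e = e'.
Proof.
move=> lf ef e'f h; apply: contraTeq ef => ne.
by rewrite (lf _ e') ?e'f // /sib ne h eqxx orbT.
Qed.

Lemma nxtE f e : local f -> e \in f -> nxt f (src e) = tgt e.
Proof.
move=> lf ef; rewrite /nxt; case: pickP => [e' /andP[e'f /eqP] | /(_ e)].
  by move=> /(local_src lf e'f ef) ->.
by rewrite /= ef eqxx.
Qed.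

Lemma dicycle_tgt c : dicycle c -> map (@tgt G) c = rot 1 (map (@src G) c).
Proof.
case: c => // e c /and3P[_ _]; rewrite map_cons rot1_cons -map_rcons /=.
suff path_map x p : path (fun e e' => tgt e == src e') x p ->
    map (@tgt G) (belast x p) = map (@src G) p.
  by move=> /path_map <-; rewrite belast_rcons.
by elim: p x => //= y p IHp x /andP[/eqP-> /IHp->].
Qed.

Lemma dicycle_fconnect f c e : local f -> dicycle c -> all [in f] c -> e \in c ->
  fconnect (nxt f) (src e) =i map (@src G) c.
Proof.
move=> lf /and3P[_ _ cc] /allP cf ec; apply: fconnect_cycle; last exact: map_f.
rewrite path.cycle_map; apply: (sub_in_cycle (P := [in f])) cc; last exact/allP.
by move=> x y xf yf /= /eqP <-; rewrite nxtE.
Qed.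

End Cycles.

Section TwoDd.
Variable G : digraph.
Hypothesis dd : is_2dd G.
Implicit Types (v : vert G) (e : darc G) (f : {set darc G}) (c : seq (darc G)).

Lemma dd_2digraph : is_2digraph G.
Proof. by move=> v; rewrite dd !orbT. Qed.

Lemma local_out f v : local f -> exists2 e, e \in f & src e = v.
Proof.
move=> lf; have /andP[_ /eqP] := dd v; rewrite /outdeg => v2.
have: 0 < #|[set e | src e == v]| by rewrite v2.
case/card_gt0P => e; rewrite inE => /eqP ev.
have [ef | ef] := boolP (e \in f); first by exists e.
exists (smate e); last by rewrite src_smate //; apply: dd_2digraph.
apply: contraNT ef => sf; rewrite (lf e (smate e)) // sibE ?eqxx //.
exact: dd_2digraph.
Qed.

Lemma local_in f v : local f -> exists2 e, e \in f & tgt e = v.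
Proof.
move=> lf; have /andP[/eqP + _] := dd v; rewrite /indeg => v2.
have: 0 < #|[set e | tgt e == v]| by rewrite v2.
case/card_gt0P => e; rewrite inE => /eqP ev.
have [ef | ef] := boolP (e \in f); first by exists e.
exists (tmate e); last by rewrite tgt_tmate //; apply: dd_2digraph.
apply: contraNT ef => sf; rewrite (lf e (tmate e)) // sibE ?eqxx ?orbT //.
exact: dd_2digraph.
Qed.

Lemma nxt_inj f : local f -> injective (nxt f).
Proof.
move=> lf u v; have [e ef <-] := local_out u lf; have [e' e'f <-] := local_out v lf.
by rewrite !nxtE // => /(local_tgt lf ef e'f) ->.
Qed.

Lemma orbit_dicycle f v : local f -> exists c,
  [/\ dicycle c, all [in f] c & map (@src G) c = orbit (nxt f) v].
Proof.
move=> lf.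
have /fin_all_exists[a aP] : forall u, exists e, e \in f /\ src e = u.
  by move=> u; have [e ef eu] := local_out u lf; exists e.
exists (map a (orbit (nxt f) v)).
have srcE : map (@src G) (map a (orbit (nxt f) v)) = orbit (nxt f) v.
  by rewrite -map_comp -[RHS]map_id; apply: eq_map => u /=; case: (aP u).
split=> //; last first.
  by apply/allP => e /mapP[u _ ->]; case: (aP u).
rewrite /dicycle srcE orbit_uniq -size_eq0 size_map size_orbit.
rewrite -lt0n fingraph.order_gt0 /=.
have: fcycle (nxt f) (map (@src G) (map a (orbit (nxt f) v))).
  by rewrite srcE; apply/cycle_orbit/nxt_inj.
move=> cc; rewrite path.cycle_map in cc.
apply: (sub_in_cycle (P := [in f])) cc; last first.
  by apply/allP => e /mapP[u _ ->]; case: (aP u).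
by move=> x y xf yf /=; rewrite nxtE.
Qed.

(** Sending a vertex [v] to the set [O v] of factor arcs that start on its orbit matches orbit
    representatives with the arc sets of directed cycles. *)
Lemma num_cyclesE f : local f -> num_cycles f = fcard (nxt f) (vert G).
Proof.
move=> lf; have sym := fconnect_sym (nxt_inj lf).
pose O v := [set e in f | fconnect (nxt f) v (src e)].
have OP c v : dicycle c -> all [in f] c -> map (@src G) c =i fconnect (nxt f) v ->
    O v = [set e in c].
  move=> dc cf cv; apply/setP => e; rewrite !inE -[X in _ && X]/(_ \in _) -cv.
  apply/andP/idP => [[ef /mapP[e' e'c h]] | ec].
    by rewrite (local_src lf ef (allP cf _ e'c) h).
  by rewrite (allP cf _ ec) map_f.
rewrite /num_cycles -[RHS](@card_in_imset _ _ O).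
  apply: eq_card => C; apply/idP/imsetP; rewrite inE.
    case/andP=> /existsP[c /andP[dc /eqP CE]] /subsetP Cf.
    have cf : all [in f] c by apply/allP => e ec; apply: Cf; rewrite CE inE.
    have [e ec] : exists e, e \in tval c.
      by case: (tval c) dc => // e c' _; exists e; rewrite mem_head.
    have cE : map (@src G) c =i fconnect (nxt f) (froot (nxt f) (src e)).
      move=> u; rewrite -(dicycle_fconnect lf dc cf ec) -[RHS]/(fconnect _ _ _).
      exact: (same_connect sym (connect_root _ _)).
    exists (froot (nxt f) (src e)); first by rewrite inE /= (roots_root sym).
    by rewrite CE (OP _ _ dc cf cE).
  case=> v _ ->; have [c [dc cf cv]] := orbit_dicycle v lf.
  have cE : map (@src G) c =i fconnect (nxt f) v.
    by move=> u; rewrite cv -fconnect_orbit.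
  rewrite (OP _ _ dc cf cE) dicycle_set //.
  by apply/subsetP => e; rewrite inE; apply: (allP cf).
move=> u v; rewrite !inE !andbT /= => /eqP ru /eqP rv Ouv.
have [e ef eu] := local_out u lf.
have: e \in O v by rewrite -Ouv inE ef eu connect0.
rewrite inE eu => /andP[_]; rewrite sym -(root_connect sym) ru rv.
by move=> /eqP.
Qed.

Lemma hamiltonianE : #|vert G| > 0 -> hamiltonian G <->
  exists f, local f /\ fcard (nxt f) (vert G) = 1.
Proof.
move=> G0; split=> [[c [dc cG]] | [f [lf /(fcard1P (nxt_inj lf))[_ fP]]]]; last first.
  have /card_gt0P[v _] := G0; have [c [dc _ cv]] := orbit_dicycle v lf.
  by exists c; split=> // u; rewrite cv -fconnect_orbit.
have uc : uniq (map (@src G) c) by case/and3P: dc.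
(* A Hamiltonian cycle contains exactly one of the two arcs leaving each vertex and one of the two
   arcs entering it, so its arc set is a factor. *)
have lf : local [set e in c].
  have uniq_inj (h : darc G -> vert G) e e' : uniq (map h c) ->
      e \in c -> e' \in c -> h e = h e' -> e = e'.
    move=> uh ec e'c hee'.
    have lt_e : index e c < size c by rewrite index_mem.
    have lt_e' : index e' c < size c by rewrite index_mem.
    rewrite -(nth_index e ec) -(nth_index e e'c); congr nth.
    apply/eqP; rewrite -(nth_uniq (h e) _ _ uh) ?size_map //.
    by rewrite !(nth_map e) // !nth_index // hee'.
  have mateC (h : darc G -> vert G) e e' :
      (forall x, #|[set y | h y == h x]| = 2) -> uniq (map h c) ->
      (forall v, v \in map h c) -> e != e' -> h e = h e' -> (e \in c) = (e' \notin c).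
    move=> h2 uh hc ne hee'; apply/idP/idP => [ec | e'c].
      by apply: contraNN ne => e'c; apply/eqP; apply: uniq_inj uh ec e'c hee'.
    have /mapP[x xc hx] := hc (h e); apply: contraNT e'c => nec.
    have nex : e != x by apply: contraNneq nec => ->.
    by rewrite (mate_eq h2 ne nex hee' hx).
  have ut : uniq (map (@tgt G) c) by rewrite dicycle_tgt // rot_uniq.
  have ct v : v \in map (@tgt G) c by rewrite dicycle_tgt // mem_rot.
  move=> e e' /andP[ne h]; rewrite !inE; case/orP: h => /eqP h.
    exact: (mateC _ _ _ (src_fiber dd_2digraph) uc).
  exact: (mateC _ _ _ (tgt_fiber dd_2digraph) ut).
exists [set e in c]; split=> //; apply/(fcard1P (nxt_inj lf)); split.
  by have /card_gt0P[v _] := G0; exists v.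
move=> u v; have /mapP[e ec ->] := cG u.
rewrite -[fconnect _ _ _]/(v \in _) (dicycle_fconnect lf dc) //.
by apply/allP => x; rewrite inE.
Qed.

End TwoDd.

(** * Induced subgraphs and gluing *)

Lemma mem_ac_of (H : digraph) (e : darc H) : e \in ac_of e.
Proof. by rewrite inE connect0. Qed.

Lemma ac_of_eq (H : digraph) (e e' : darc H) : e' \in ac_of e -> ac_of e' = ac_of e.
Proof.
rewrite inE => ee'; apply/setP => x; rewrite !inE.
by rewrite (same_connect (@sib_connect_sym H) ee').
Qed.

Lemma ac_of_sib (H : digraph) (e e' : darc H) : sib e e' -> ac_of e' = ac_of e.
Proof. by move=> s; apply: ac_of_eq; rewrite inE connect1. Qed.

(** The last hypothesis makes the image of [h] closed under siblings, so [h] maps alternating cycles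
    onto entire alternating cycles. This gives the invariance of their sizes under inducing, gluing
    and disjoint union. *)
Lemma card_ac_of_morph (H H' : digraph) (h : darc H -> darc H') (e : darc H) :
  injective h -> (forall x y, sib (h x) (h y) = sib x y) ->
  (forall x y', sib (h x) y' -> exists y, y' = h y) -> #|ac_of (h e)| = #|ac_of e|.
Proof.
move=> injh sibh imh; rewrite -(card_imset _ injh); apply: eq_card => x'.
apply/idP/imsetP; rewrite inE.
  case/connectP=> p + ->; elim: p e => [|y' p IHp] e /=.
    by exists e; rewrite ?mem_ac_of.
  case/andP=> /[dup] /imh[y ->]; rewrite sibh => ey /IHp[z zA ->].
  by exists z => //; rewrite -(ac_of_sib ey).
case=> x; rewrite inE => /connectP[p + ->] ->.
elim: p e {x} => [|y p IHp] e /=; first by rewrite connect0.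
case/andP=> ey /IHp; apply: connect_trans; apply: connect1; by rewrite sibh.
Qed.

Lemma all_ACs_size6P (H : digraph) : is_2digraph H ->
  all_ACs_size6 H <-> forall e : darc H, #|ac_of e| = 6.
Proof.
move=> H2; split=> [h e | h A /(ACsP H2)[e ->] //].
by apply/h/(ACsP H2); exists e.
Qed.

Section Induced.
Variables (G : digraph) (dd : is_2dd G) (D : {set darc G}).
Hypothesis clD : forall e e', sib e e' -> (e \in D) = (e' \in D).
Let F := arc_induced D.

Definition sources := @src G @: D.
Definition targets := @tgt G @: D.

Lemma mem_endpoints v : (v \in endpoints D) = (v \in sources) || (v \in targets).
Proof.
rewrite inE; apply/existsP/orP.
  by case=> e /andP[eD /orP[]/eqP<-]; [left | right]; apply: imset_f.
by case=> /imsetP[e eD ->]; exists e; rewrite eD eqxx ?orbT.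
Qed.

Lemma mem_sources e : (src e \in sources) = (e \in D).
Proof.
apply/imsetP/idP => [[e' e'D h] | eD]; last by exists e.
have [-> // | ne] := eqVneq e e'.
by rewrite (clD (e' := e')) // /sib ne h eqxx.
Qed.

Lemma mem_targets e : (tgt e \in targets) = (e \in D).
Proof.
apply/imsetP/idP => [[e' e'D h] | eD]; last by exists e.
have [-> // | ne] := eqVneq e e'.
by rewrite (clD (e' := e')) // /sib ne h eqxx orbT.
Qed.

(** As [D] is closed under siblings, the two arcs leaving a vertex are both kept or both dropped. *)
Lemma outdeg_induced (v : vert F) : outdeg v = if val v \in sources then 2 else 0.
Proof.
rewrite /outdeg -(card_imset _ val_inj) /=.
case: ifPn => [vX | vX].
  have /andP[_ /eqP <-] := dd (val v); apply: eq_card => e; rewrite inE.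
  apply/imsetP/eqP => [[e' + ->] | ev]; first by rewrite inE => /eqP<-.
  have eD : e \in D by rewrite -mem_sources ev.
  by exists (Sub e eD); rewrite ?inE -?val_eqE /= ?ev.
apply: eq_card0 => e; rewrite inE; apply: contraNF vX => /imsetP[e' + _].
by rewrite inE => /eqP<- /=; apply/imset_f/(valP e').
Qed.

Lemma indeg_induced (v : vert F) : indeg v = if val v \in targets then 2 else 0.
Proof.
rewrite /indeg -(card_imset _ val_inj) /=.
case: ifPn => [vX | vX].
  have /andP[/eqP <- _] := dd (val v); apply: eq_card => e; rewrite inE.
  apply/imsetP/eqP => [[e' + ->] | ev]; first by rewrite inE => /eqP<-.
  have eD : e \in D by rewrite -mem_targets ev.
  by exists (Sub e eD); rewrite ?inE -?val_eqE /= ?ev.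
apply: eq_card0 => e; rewrite inE; apply: contraNF vX => /imsetP[e' + _].
by rewrite inE => /eqP<- /=; apply/imset_f/(valP e').
Qed.

Lemma is_entry_induced (v : vert F) : is_entry v = (val v \in sources :\: targets).
Proof.
by rewrite /is_entry indeg_induced outdeg_induced inE; do 2!case: ifP.
Qed.

Lemma is_exit_induced (v : vert F) : is_exit v = (val v \in targets :\: sources).
Proof.
by rewrite /is_exit indeg_induced outdeg_induced inE; do 2!case: ifP.
Qed.

Lemma is_saturated_induced (v : vert F) : is_saturated v = (val v \in sources :&: targets).
Proof.
by rewrite /is_saturated indeg_induced outdeg_induced inE; do 2!case: ifP.
Qed.

Lemma induced_2digraph : is_2digraph F.
Proof.
move=> v; rewrite is_entry_induced is_exit_induced is_saturated_induced !inE.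
have := valP v; rewrite mem_endpoints.
by case: (_ \in sources); case: (_ \in targets).
Qed.

Lemma card_ac_of_induced (e : darc F) : #|ac_of e| = #|ac_of (val e)|.
Proof.
rewrite (@card_ac_of_morph F G val) //; first exact: val_inj.
move=> x y xy; have yD : y \in D by rewrite -(clD xy) (valP x).
by exists (Sub y yD).
Qed.

End Induced.

Arguments sources {G} D.
Arguments targets {G} D.

Section Glue.
Variables (H : digraph) (E : rel (vert H)).
Hypothesis H2 : is_2digraph H.
Hypothesis E_ee : forall x y, E x y -> is_exit x /\ is_entry y.
Hypothesis E_fun : forall x y y', E x y -> E x y' -> y = y'.
Hypothesis E_inj : forall x x' y, E x y -> E x' y -> x = x'.
Hypothesis E_exit : forall x, is_exit x -> exists y, E x y.
Hypothesis E_entry : forall y, is_entry y -> exists x, E x y.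

Definition glue_class (x : vert H) : vert (glue E) :=
  Sub (root (symc E) x) (roots_root (symc_connect_sym E) x).

Lemma glue_classK (v : vert (glue E)) : glue_class (val v) = v.
Proof. by apply: val_inj => /=; apply/eqP/(valP v). Qed.

Lemma glue_rep (x : vert H) : connect (symc E) x (val (glue_class x)).
Proof. exact: connect_root. Qed.

Lemma exit_entryF (x : vert H) : is_exit x -> is_entry x -> False.
Proof. by move=> /andP[/eqP h _]; rewrite /is_entry h. Qed.

(** The relation matches exits with entries, and no vertex is both; hence paths of [E]-steps
    collapse to length at most one and every class has at most two elements. *)
Lemma glue_classE x y : (glue_class x == glue_class y) = [|| x == y, E x y | E y x].
Proof.
rewrite -val_eqE /= (root_connect (symc_connect_sym E)); apply/idP/or3P; last first.
  by case=> [/eqP-> | xy | yx]; rewrite ?connect0 //; apply: connect1;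
    rewrite /symc ?xy ?yx ?orbT.
case/connectP=> p; elim/last_ind: p y => [|p z IHp] y; first by move=> _ ->; constructor.
rewrite last_rcons rcons_path => /andP[/IHp/(_ erefl) + + ->].
move: (last x p) => {p y IHp} y xy /orP[yz | zy].
  case: xy => [/eqP-> | xy | yx]; first by constructor 2.
    by case: (exit_entryF (E_ee yz).1 (E_ee xy).2).
  by rewrite (E_fun yz yx); constructor.
case: xy => [/eqP-> | xy | yx]; first by constructor 3.
  by rewrite (E_inj zy xy); constructor.
by case: (exit_entryF (E_ee yx).1 (E_ee zy).2).
Qed.

Lemma src_not_exit (e : darc H) : ~ is_exit (src e).
Proof.
by case/andP=> _ /eqP/eqP; rewrite cards_eq0 => /eqP/setP/(_ e); rewrite !inE eqxx.
Qed.

Lemma tgt_not_entry (e : darc H) : ~ is_entry (tgt e).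
Proof.
by case/andP=> /eqP/eqP + _; rewrite cards_eq0 => /eqP/setP/(_ e); rewrite !inE eqxx.
Qed.

Lemma src_glue (e : darc (glue E)) : src e = glue_class (src (e : darc H)).
Proof. by []. Qed.

Lemma tgt_glue (e : darc (glue E)) : tgt e = glue_class (tgt (e : darc H)).
Proof. by []. Qed.

(** An exit has no outgoing and an entry no incoming arcs, so identifying them gives no two arcs a
    new common start-vertex or end-vertex. Alternating cycles and factors are therefore
    unchanged. *)
Lemma sib_glue (e e' : darc H) : @sib (glue E) e e' = sib e e'.
Proof.
rewrite /sib !src_glue !tgt_glue !glue_classE.
suff [-> ->] : (E (src e) (src e') || E (src e') (src e) = false) /\
               (E (tgt e) (tgt e') || E (tgt e') (tgt e) = false).
  by rewrite !orbF.
split; apply/negbTE/negP; case/orP=> /E_ee[].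
- by move/src_not_exit.
- by move/src_not_exit.
- by move=> _ /tgt_not_entry.
- by move=> _ /tgt_not_entry.
Qed.

(** A merged vertex takes its two in-arcs from the exit and its two out-arcs from the entry. *)
Lemma glue_2dd : is_2dd (glue E).
Proof.
move=> v; rewrite -(glue_classK v); move: (val v) => x {v}.
have nEx y : ~~ is_exit x -> E x y = false by move=> h; apply: contraNF h => /E_ee[].
have nEy y : ~~ is_entry x -> E y x = false by move=> h; apply: contraNF h => /E_ee[].
apply/andP; split; apply/eqP.
  transitivity #|[set e : darc H | (tgt e == x) || E (tgt e) x]|.
    apply: eq_card => e; rewrite !inE tgt_glue glue_classE.
    have -> : E x (@tgt H e) = false by apply/negP => /E_ee[_ /tgt_not_entry].
    by rewrite orbF.
  have [xe | xe] := boolP (is_entry x).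
    have [y yx] := E_entry xe; have /andP[/eqP <- _] := (E_ee yx).1.
    apply: eq_card => e; rewrite !inE; apply/orP/eqP => [[/eqP ex | ex] | ->].
    - by case: (@tgt_not_entry e); rewrite ex.
    - exact: E_inj ex yx.
    - by right.
  have /eqP <- : indeg x == 2.
    by move: (H2 x); rewrite (negPf xe) /= => /orP[] /andP[].
  by apply: eq_card => e; rewrite !inE nEy // orbF.
transitivity #|[set e : darc H | (src e == x) || E x (src e)]|.
  apply: eq_card => e; rewrite !inE src_glue glue_classE.
  have -> : E (@src H e) x = false by apply/negP => /E_ee[/src_not_exit].
  by [].
have [xe | xe] := boolP (is_exit x).
  have [y yx] := E_exit xe; have /andP[_ /eqP <-] := (E_ee yx).2.
  apply: eq_card => e; rewrite !inE; apply/orP/eqP => [[/eqP ex | ex] | ->].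
  - by case: (@src_not_exit e); rewrite ex.
  - exact: E_fun ex yx.
  - by right.
have /eqP <- : outdeg x == 2.
  by move: (H2 x); rewrite (negPf xe) /= => /orP[] /andP[].
by apply: eq_card => e; rewrite !inE nEx // orbF.
Qed.

Lemma card_ac_of_glue (e : darc H) : #|@ac_of (glue E) e| = #|ac_of e|.
Proof.
apply: (@card_ac_of_morph H (glue E) id) => //.
  by move=> x y; rewrite sib_glue.
by move=> x y _; exists y.
Qed.

Lemma local_glue (f : {set darc H}) : @local (glue E) f <-> local f.
Proof. by split=> lf x y; have := lf x y; rewrite sib_glue. Qed.

End Glue.

Section Union.
Variables (H H' : digraph).
Let U := disjoint_union H H'.

Lemma sib_inl (x y : darc H) : @sib U (inl x) (inl y) = sib x y.
Proof. by []. Qed.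

Lemma sib_inr (x y : darc H') : @sib U (inr x) (inr y) = sib x y.
Proof. by []. Qed.

Lemma degree_inl (v : vert H) :
  @indeg U (inl v) = indeg v /\ @outdeg U (inl v) = outdeg v.
Proof.
split; rewrite -[RHS](card_imset _ (@inl_inj _ (darc H'))); apply: eq_card => -[e|e];
  rewrite !inE /= ?(mem_imset _ _ inl_inj) ?inE //;
  by apply/esym/imsetP => -[].
Qed.

Lemma degree_inr (v : vert H') :
  @indeg U (inr v) = indeg v /\ @outdeg U (inr v) = outdeg v.
Proof.
split; rewrite -[RHS](card_imset _ (@inr_inj (darc H) _)); apply: eq_card => -[e|e];
  rewrite !inE /= ?(mem_imset _ _ inr_inj) ?inE //;
  by apply/esym/imsetP => -[].
Qed.

Lemma union_2digraph : is_2digraph H -> is_2digraph H' -> is_2digraph U.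
Proof.
move=> H2 H2' [v | v]; rewrite /is_entry /is_exit /is_saturated.
  by have [-> ->] := degree_inl v; apply: H2.
by have [-> ->] := degree_inr v; apply: H2'.
Qed.

Lemma card_ac_of_inl (e : darc H) : #|@ac_of U (inl e)| = #|ac_of e|.
Proof.
apply: (@card_ac_of_morph H U inl) => //; first exact: inl_inj.
by move=> x [y | y] //; exists y.
Qed.

Lemma card_ac_of_inr (e : darc H') : #|@ac_of U (inr e)| = #|ac_of e|.
Proof.
apply: (@card_ac_of_morph H' U inr) => //; first exact: inr_inj.
by move=> x [y | y] //; exists y.
Qed.

End Union.

Section Cover.
Variables (G : digraph) (dd : is_2dd G) (K : {set {set darc G}}).
Hypothesis KA : K \subset ACs G.

Lemma mem_cover_ACs e : (e \in cover K) = (ac_of e \in K).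
Proof.
apply/bigcupP/idP => [[A AK eA] | eK]; last by exists (ac_of e); rewrite ?mem_ac_of.
have /(ACsP (dd_2digraph dd))[x AE] := subsetP KA _ AK.
by rewrite AE in AK eA; rewrite (ac_of_eq eA).
Qed.

Lemma cover_closed e e' : sib e e' -> (e \in cover K) = (e' \in cover K).
Proof. by move=> s; rewrite !mem_cover_ACs (ac_of_sib s). Qed.

End Cover.

Lemma mem_cover_complement (G : digraph) (K : {set {set darc G}}) (e : darc G) :
  is_2dd G -> K \subset ACs G ->
  (e \in cover (ACs G :\: K)) = (e \notin cover K).
Proof.
move=> dd KA; rewrite !mem_cover_ACs ?subsetDl // inE andbC.
by have -> : ac_of e \in ACs G by apply/(ACsP (dd_2digraph dd)); exists e.
Qed.

Lemma dicycle_induced (G : digraph) (D : {set darc G}) (c : seq (darc (arc_induced D))) :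
  dicycle c = dicycle (map val c).
Proof.
rewrite /dicycle -!size_eq0 size_map; congr [&& _, _ & _].
  by rewrite -[LHS](map_inj_uniq val_inj) -!map_comp.
by rewrite path.cycle_map; apply: eq_cycle => x y.
Qed.

(** * Open factors and routes of a subgraph *)

Section Subgraph.
Variables (G : digraph) (dd : is_2dd G) (K : {set {set darc G}}).
Hypothesis KA : K \subset ACs G.
Notation D := (cover K).
Notation X := (sources D).
Notation Y := (targets D).
Notation F := (subgraph K).
Implicit Types (e : darc G) (v : vert G) (f g : {set darc G}).

Let clD := cover_closed dd KA.

Lemma mem_cover_src e : (src e \in X) = (e \in D).
Proof. exact: mem_sources clD e. Qed.

Lemma mem_cover_tgt e : (tgt e \in Y) = (e \in D).
Proof. exact: mem_targets clD e. Qed.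

Lemma nxt_targets f v : local f -> (nxt f v \in Y) = (v \in X).
Proof.
move=> lf; have [e ef <-] := local_out dd v lf.
by rewrite nxtE // mem_cover_src mem_cover_tgt.
Qed.

Lemma nxt_sources f : local f -> nxt f @: X = Y.
Proof.
move=> lf; apply/setP => v; apply/imsetP/idP => [[u uX ->] | vY].
  by rewrite nxt_targets.
have [e ef ev] := local_in dd v lf.
by exists (src e); rewrite ?nxtE // mem_cover_src -mem_cover_tgt ev.
Qed.

Definition splice f g := (f :\: D) :|: (g :&: D).

Lemma mem_splice f g e : (e \in splice f g) = if e \in D then e \in g else e \in f.
Proof. by rewrite !inE; case: (e \in D); rewrite ?andbT ?andbF ?orbF. Qed.

Lemma splice_local f g : local f -> local g -> local (splice f g).
Proof.
move=> lf lg x y xy; rewrite !mem_splice -(clD xy).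
by case: ifP => _; [apply: lg | apply: lf].
Qed.

Lemma nxt_splice f g v : local f -> local g ->
  nxt (splice f g) v = if v \in X then nxt g v else nxt f v.
Proof.
move=> lf lg; have [e es <-] := local_out dd v (splice_local lf lg).
rewrite nxtE //; last exact: splice_local.
by move: es; rewrite mem_splice mem_cover_src; case: ifP => _ ef; rewrite nxtE.
Qed.

Lemma splice_leaves f g : local f -> local g -> leaves X (nxt g) ->
  leaves X (nxt (splice f g)) /\ leave X (nxt g) =1 leave X (nxt (splice f g)).
Proof.
by move=> lf lg og; apply: leave_eq => // v vX; rewrite nxt_splice ?vX.
Qed.

Definition restr f : {set darc F} := [set e | val e \in f].

Definition extend f (h : {set darc F}) : {set darc G} := (f :\: D) :|: (val @: h).

Lemma mem_extend f (h : {set darc F}) (e : darc F) : (val e \in extend f h) = (e \in h).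
Proof. by rewrite !inE (valP e) /= mem_imset //; apply: val_inj. Qed.

Lemma restr_extend f h : restr (extend f h) = h.
Proof. by apply/setP => e; rewrite inE mem_extend. Qed.

Lemma restr_local f : local f -> local (restr f).
Proof. by move=> lf x y xy; rewrite !inE; apply: lf. Qed.

Lemma extend_local f (h : {set darc F}) : local f -> local h -> local (extend f h).
Proof.
move=> lf lh x y xy; have [xD | xD] := boolP (x \in D).
  have yD : y \in D by rewrite -(clD xy).
  rewrite -[x]/(val (Sub x xD : darc F)) -[y]/(val (Sub y yD : darc F)).
  by rewrite !mem_extend; apply: lh.
have yD : y \notin D by rewrite -(clD xy).
have outE z : z \notin D -> (z \in extend f h) = (z \in f).
  move=> zD; rewrite !inE zD /= orb_idr // => /imsetP[w _ zw].
  by move: zD; rewrite zw (valP w).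
by rewrite !outE //; apply: lf.
Qed.

(** A cycle of [f] uses only arcs of the subgraph exactly when all its vertices lie in [X], that is,
    when [nxt f] never leaves [X] along it. *)
Lemma restr_open f : local f -> is_open (restr f) <-> leaves X (nxt f).
Proof.
move=> lf; split=> [/openP fo x | lp].
  have [y /andP[xy yX] | none] := pickP (fun y => fconnect (nxt f) x y && (y \notin X)).
    by exists (findex (nxt f) x y); rewrite iter_findex.
  have [c [dc /allP cf cx]] := orbit_dicycle dd x lf.
  have cD e : e \in c -> e \in D.
    move=> ec; rewrite -mem_cover_src; apply: contraFT (none (src e)) => ->.
    by rewrite andbT fconnect_orbit -cx map_f.
  have [c' cE] : exists c' : seq (darc F), map val c' = c.
    elim: c cD {dc cf cx} => [|e c IHc] cD; first by exists [::].
    have [|c' <-] := IHc; first by move=> z zc; rewrite cD ?inE ?zc ?orbT.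
    by exists (Sub e (cD e (mem_head e c)) :: c').
  have /fo/negP[] : dicycle c' by rewrite dicycle_induced cE.
  by apply/allP => e ec; rewrite inE; apply: cf; rewrite -cE map_f.
apply/openP => c dc; apply/negP => /allP cf.
case: c dc cf => // e c dc cf.
have ef : all [in f] (map val (e :: c)).
  by apply/allP => _ /mapP[z zc ->]; have := cf _ zc; rewrite inE.
have dc' : dicycle (map val (e :: c)) by rewrite -dicycle_induced.
have := leave_fconnect (src (val e)) lp; rewrite -[fconnect _ _ _]/(_ \in _).
rewrite (dicycle_fconnect lf dc' ef) ?mem_head // => /mapP[_ /mapP[z _ ->] zE].
by have := leave_notin (src (val e)) lp; rewrite zE mem_cover_src (valP z).
Qed.

Lemma step_restr f (x y : vert F) : local f ->
  step (restr f) x y = (val x \in X) && (nxt f (val x) == val y).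
Proof.
move=> lf; apply/existsP/andP => [[e /and3P[ef /eqP<- /eqP<-]] | [xX /eqP xy]].
  by rewrite inE in ef; rewrite mem_cover_src (valP e) nxtE.
have [e ef ex] := local_out dd (val x) lf.
have eD : e \in D by rewrite -mem_cover_src ex.
exists (Sub e eD); rewrite inE ef -!val_eqE /= ex eqxx /=.
by rewrite -xy -ex nxtE.
Qed.

Lemma leave_endpoints f v : local f -> leaves X (nxt f) -> v \in X ->
  leave X (nxt f) v \in Y.
Proof. by move=> lf lp vX; rewrite -(nxt_sources lf) leave_in. Qed.

(** From an entry vertex the path inside the subgraph follows [nxt f] as long as it is in [X], so
    its end is the first vertex outside [X]. *)
Lemma route_leave f r : local f -> leaves X (nxt f) ->
  is_route (restr f) r <->
  forall u, val (val (r u)) = leave X (nxt f) (val (val u)).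
Proof.
move=> lf lp; split=> rP u.
  have /connectP[p + rE] := rP u.
  suff leave_last x : path (step (restr f)) x p ->
      leave X (nxt f) (val (last x p)) = leave X (nxt f) (val x).
    move=> /leave_last <-; rewrite -rE leave_out //.
    by have := valP (r u); rewrite is_exit_induced // !inE => /andP[].
  elim: p x {rE} => //= y p IHp x /andP[+ /IHp->].
  by rewrite step_restr // => /andP[xX /eqP <-]; rewrite -leave_step.
have [m [+ _ mP]] := leaveP (val (val u)) lp; rewrite -rP.
move: (val (r u)) (val u) mP => w x; elim: m x => [|m IHm] x mP.
  by move=> /= /val_inj ->; apply: connect0.
have xX := mP 0 isT; rewrite iterSr => wE.
have yF : nxt f (val x) \in endpoints D.
  by rewrite mem_endpoints nxt_targets // xX orbT.
apply: (@connect_trans _ _ (Sub (nxt f (val x)) yF : vert F)).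
  by apply: connect1; rewrite step_restr // xX eqxx.
by apply: IHm => // i lt_im; rewrite -iterSr; apply: mP.
Qed.

Lemma exists_route f : local f -> leaves X (nxt f) ->
  exists r : {ffun entry F -> exit F},
    forall u, val (val (r u)) = leave X (nxt f) (val (val u)).
Proof.
move=> lf lp.
have /fin_all_exists[r rP] : forall u : entry F, exists w : exit F,
    val (val w) = leave X (nxt f) (val (val u)).
  move=> u; have := valP u; rewrite is_entry_induced // inE => /andP[_ uX].
  have wY := leave_endpoints lf lp uX.
  have wF : leave X (nxt f) (val (val u)) \in endpoints D.
    by rewrite mem_endpoints wY orbT.
  pose w : vert F := Sub (leave X (nxt f) (val (val u))) wF.
  have we : is_exit w by rewrite is_exit_induced // inE wY leave_notin.
  by exists (Sub w we).
by exists [ffun u => r u] => u; rewrite ffunE rP.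
Qed.

(** Expresses routes through factors of the whole of [G]; afterwards routes are handled only as
    values of [leave]. *)
Lemma open_routeE (r : {ffun entry F -> exit F}) : open_route r <->
  exists f, [/\ local f, leaves X (nxt f)
    & forall u, val (val (r u)) = leave X (nxt f) (val (val u))].
Proof.
have F2 : is_2digraph F := induced_2digraph dd clD.
split=> [[h [/(factor_local F2) lh oh rh]] | [f [lf lp rP]]].
  (* Any factor [f0] serves to complete [h] outside the subgraph. *)
  have [f0 lf0] := exists_local (dd_2digraph dd).
  exists (extend f0 h); have lf := extend_local lf0 lh.
  have lp : leaves X (nxt (extend f0 h)) by apply/restr_open; rewrite ?restr_extend.
  by split=> //; apply/route_leave; rewrite ?restr_extend.
exists (restr f); split; first exact/local_factor/restr_local.
  exact/restr_open.
exact/route_leave.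
Qed.

End Subgraph.

(** * Collapsing *)

Section GlueTransfer.
Variables (G : digraph) (dd : is_2dd G) (f : {set darc G}) (lf : local f).
Variables (H : digraph) (E : rel (vert H)) (dd' : is_2dd (glue E)).
Variables (f' : {set darc H}) (lf' : @local (glue E) f').
Variables (phi : vert H -> vert G) (psi : vert G -> vert H).
Let p' := @nxt (glue E) f'.

(* phi and psi induce mutually inverse bijections between the cycles of f' in the
   glued digraph and those of f. *)
Lemma glue_fcard :
  (forall x y, E x y -> fconnect (nxt f) (phi x) (phi y)) ->
  (forall e, e \in f' -> fconnect (nxt f) (phi (src e)) (phi (tgt e))) ->
  (forall v, fconnect (nxt f) v (phi (psi v))) ->
  (forall v, fconnect p' (glue_class E (psi v)) (glue_class E (psi (nxt f v)))) ->
  (forall x, fconnect p' (glue_class E x) (glue_class E (psi (phi x)))) ->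
  fcard (nxt f) (vert G) = fcard p' (vert (glue E)).
Proof.
move=> EP fP phipsi psiP psiphi.
have sym := fconnect_sym (nxt_inj dd lf).
have sym' : connect_sym (frel p') := fconnect_sym (nxt_inj dd' lf').
(* Identified vertices have images on one cycle of [f], so the choice of class representatives is
   harmless. *)
have repP x : fconnect (nxt f) (phi x) (phi (val (glue_class E x))).
  have /connectP[s + ->] := glue_rep E x.
  elim: s x => [|y s IHs] x /=; first by rewrite connect0.
  case/andP=> /orP[/EP xy | /EP yx] /IHs; first exact: connect_trans.
  by apply: connect_trans; rewrite sym.
apply: (@n_comp_equiv _ _ _ _ (phi \o val) (glue_class E \o psi)) => //.
- by move=> x y /eqP<-; apply: psiP.
- move=> x y /eqP<- /=; have [e ef <-] := local_out dd' x lf'.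
  rewrite /p' nxtE // src_glue tgt_glue.
  apply: connect_trans (repP _); apply: connect_trans (fP e ef).
  by rewrite sym; apply: repP.
- by move=> v; apply: connect_trans (phipsi v) (repP _).
- by move=> x; rewrite -{1}(glue_classK x); apply: psiphi.
Qed.

End GlueTransfer.

Section Complement.
Variables (G : digraph) (dd : is_2dd G) (K : {set {set darc G}}).
Hypothesis KA : K \subset ACs G.
Notation D := (cover K).
Notation X := (sources D).
Notation Y := (targets D).
Notation K' := (ACs G :\: K).
Notation H := (complement K).
Implicit Types (e : darc G) (v : vert G) (f g : {set darc G}).

Lemma complement_sub : K' \subset ACs G. Proof. exact: subsetDl. Qed.

Lemma sources_complement v : (v \in sources (cover K')) = (v \notin X).
Proof.
have [f lf] := exists_local (dd_2digraph dd); have [e _ <-] := local_out dd v lf.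
by rewrite !mem_cover_src ?complement_sub // mem_cover_complement.
Qed.

Lemma targets_complement v : (v \in targets (cover K')) = (v \notin Y).
Proof.
have [f lf] := exists_local (dd_2digraph dd); have [e _ <-] := local_in dd v lf.
by rewrite !mem_cover_tgt ?complement_sub // mem_cover_complement.
Qed.

Lemma complement_2digraph : is_2digraph H.
Proof. exact (induced_2digraph dd (cover_closed dd complement_sub)). Qed.

Lemma is_entry_complement (x : vert H) : is_entry x = (val x \in Y :\: X).
Proof.
rewrite (is_entry_induced dd (cover_closed dd complement_sub)) !inE.
by rewrite sources_complement targets_complement negbK andbC.
Qed.

Lemma is_exit_complement (x : vert H) : is_exit x = (val x \in X :\: Y).
Proof.
rewrite (is_exit_induced dd (cover_closed dd complement_sub)) !inE.
by rewrite sources_complement targets_complement negbK andbC.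
Qed.

Lemma complement_vert v : (v \in endpoints (cover K')) = (v \notin X :&: Y).
Proof. by rewrite mem_endpoints sources_complement targets_complement inE negb_and. Qed.


End Complement.

Section Collapse.
Variables (G : digraph) (dd : is_2dd G) (K : {set {set darc G}}).
Hypothesis KA : K \subset ACs G.
Notation D := (cover K).
Notation X := (sources D).
Notation Y := (targets D).
Notation K' := (ACs G :\: K).
Notation F := (subgraph K).
Notation H := (complement K).
Variables (f : {set darc G}) (r : {ffun entry F -> exit F}).
Hypotheses (lf : local f) (lp : leaves X (nxt f)).
Hypothesis rP : forall u, val (val (r u)) = leave X (nxt f) (val (val u)).

Let E (x y : vert H) :=
  [exists u : entry F, (val x == val (val u)) && (val y == val (val (r u)))].

Lemma collapse_rel x y :
  E x y = (val x \in X :\: Y) && (val y == leave X (nxt f) (val x)).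
Proof.
apply/existsP/andP => [[u /andP[/eqP xu /eqP yu]] | [xXY /eqP yx]].
  by have := valP u; rewrite is_entry_induced ?xu ?yu ?rP //; apply: cover_closed.
have xF : val x \in endpoints D.
  by rewrite mem_endpoints; move: xXY; rewrite inE => /andP[_ ->].
pose u : vert F := Sub (val x) xF.
have ue : is_entry u by rewrite is_entry_induced //; apply: cover_closed.
by exists (Sub u ue); rewrite rP /= yx !eqxx.
Qed.

(** The first vertex outside [X] always survives in the complement, which lacks only the vertices of
    [X :&: Y]. *)
Lemma exists_leave_vert : exists psi : vert G -> vert H,
  forall v, val (psi v) = leave X (nxt f) v.
Proof.
apply: (@fin_all_exists _ _ (fun v x => val x = _)) => v.
have vH : leave X (nxt f) v \in endpoints (cover K').
  by rewrite complement_vert // inE (negPf (leave_notin _ lp)).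
by exists (Sub (leave X (nxt f) v) vH).
Qed.

Lemma leave_targets v : v \in X :\: Y -> leave X (nxt f) v \in Y :\: X.
Proof.
by rewrite !inE => /andP[_ vX]; rewrite leave_notin //= (leave_endpoints dd KA).
Qed.

Lemma collapse_ee x y : E x y -> is_exit x /\ is_entry y.
Proof.
rewrite collapse_rel is_exit_complement // is_entry_complement // => /andP[xXY /eqP->].
by rewrite leave_targets.
Qed.

Lemma collapse_fun x y y' : E x y -> E x y' -> y = y'.
Proof.
rewrite !collapse_rel => /andP[_ /eqP xy] /andP[_ /eqP xy'].
by apply: val_inj; rewrite xy xy'.
Qed.

Lemma collapse_inj x x' y : E x y -> E x' y -> x = x'.
Proof.
rewrite !collapse_rel => /andP[xXY /eqP ->] /andP[xXY' /eqP e].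
apply/val_inj/(leave_inj (nxt_inj dd lf) lp) => //; rewrite inE /= nxt_sources //.
  by move: xXY; rewrite inE => /andP[].
by move: xXY'; rewrite inE => /andP[].
Qed.

Lemma collapse_exit x : is_exit x -> exists y, E x y.
Proof.
rewrite is_exit_complement // => xXY; have [psi psiP] := exists_leave_vert.
by exists (psi (val x)); rewrite collapse_rel xXY psiP /=.
Qed.

Lemma collapse_entry y : is_entry y -> exists x, E x y.
Proof.
rewrite is_entry_complement // -(nxt_sources dd KA lf).
rewrite -(leave_onto (nxt_inj dd lf) lp) (nxt_sources dd KA lf) => /imsetP[v vXY yE].
have vH : v \in endpoints (cover K').
  by rewrite complement_vert //; move: vXY; rewrite !inE => /andP[/negPf-> _]; rewrite andbF.
by exists (Sub v vH); rewrite collapse_rel /= vXY yE /=.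
Qed.

Let H2 := @complement_2digraph G dd K.

Lemma collapse_2dd : is_2dd (collapse r).
Proof.
exact (glue_2dd H2 collapse_ee collapse_fun collapse_inj collapse_exit collapse_entry).
Qed.

Lemma local_collapse (h : {set darc H}) : @local (collapse r) h <-> local h.
Proof. exact: (local_glue collapse_ee collapse_fun collapse_inj). Qed.

Lemma collapse_size6 : all_ACs_size6 G -> all_ACs_size6 (collapse r).
Proof.
move=> /(all_ACs_size6P (dd_2digraph dd)) G6.
apply/(all_ACs_size6P (dd_2digraph collapse_2dd)) => e.
rewrite (card_ac_of_glue collapse_ee collapse_fun collapse_inj).
by rewrite (card_ac_of_induced (cover_closed dd (complement_sub K))) G6.
Qed.

(* f carries the open factor of the subgraph, h any factor of the collapsed digraph. *)
Lemma collapse_fcard (h : {set darc H}) : @local (collapse r) h ->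
  fcard (@nxt (collapse r) h) (vert (collapse r)) =
  fcard (nxt (@extend G K' f h)) (vert G).
Proof.
move=> lh'; have lh : local h by apply/local_collapse.
have K'A := complement_sub K.
set g := extend f h; have lg : local g := extend_local dd K'A lf lh.
have gX e : e \in D -> (e \in g) = (e \in f).
  move=> eD; rewrite !inE mem_cover_complement // eD /= orb_idr // => /imsetP[w _ ew].
  have: e \in cover K' by rewrite ew; apply: (valP w).
  by rewrite mem_cover_complement // eD.
have [og leaveE] : leaves X (nxt g) /\ leave X (nxt f) =1 leave X (nxt g).
  apply: leave_eq => // v vX; have [e ef ev] := local_out dd v lf.
  have eg : e \in g by rewrite gX // -(mem_cover_src dd KA) ev.
  by rewrite -ev !nxtE.
have [psi psiP] := exists_leave_vert.
(* A vertex of the complement lying in [X] is an exit there, and it is glued precisely to the vertex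
   at which [f] leaves the subgraph. *)
have classE x : glue_class E (psi (val x)) = glue_class E x.
  apply/eqP; rewrite (glue_classE collapse_ee collapse_fun collapse_inj).
  have [xX | xX] := boolP (val x \in X).
    have xXY : val x \in X :\: Y.
      by have := valP x; rewrite complement_vert // !inE xX /= => ->.
    by rewrite [E x _]collapse_rel psiP xXY eqxx !orbT.
  by rewrite -val_eqE psiP leave_out // eqxx.
(* Vertices of the complement are included into [G]; in the other direction a vertex is pushed along
   [g] until it is outside [X]. An arc inside the subgraph becomes a trivial step. *)
symmetry; apply: (glue_fcard dd lg collapse_2dd lh' (phi := val) (psi := psi)).
- move=> x y; rewrite -/(E x y) collapse_rel leaveE => /andP[_ /eqP->].
  exact: leave_fconnect.
- move=> e eh; apply: (@connect_trans _ _ (nxt g (val (src e)))); first exact: fconnect1.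
  by rewrite nxtE ?mem_extend // connect0.
- by move=> v; rewrite psiP leaveE; apply: leave_fconnect.
- move=> v; have [vX | vX] := boolP (v \in X).
    rewrite (_ : psi v = psi (nxt g v)) ?connect0 //.
    by apply: val_inj; rewrite !psiP !leaveE leave_step.
  have [e eg ev] := local_out dd v lg.
  have eD : e \in cover K'.
    by rewrite mem_cover_complement // -(mem_cover_src dd KA) ev.
  pose e' : darc H := Sub e eD.
  have e'h : e' \in h by rewrite -(mem_extend f).
  have -> : glue_class E (psi v) = @src (collapse r) e'.
    rewrite src_glue -[RHS]classE; congr (glue_class E _); apply: val_inj.
    by rewrite !psiP /= ev.
  have -> : glue_class E (psi (nxt g v)) = @tgt (collapse r) e'.
    rewrite tgt_glue -[RHS]classE; congr (glue_class E _); apply: val_inj.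
    by rewrite !psiP /= -ev nxtE.
  by rewrite -(nxtE (G := collapse r) lh' e'h); apply: fconnect1.
- by move=> x; rewrite classE connect0.
Qed.

End Collapse.

Lemma extend_restr (G : digraph) (K : {set {set darc G}}) (f : {set darc G}) :
  extend f (restr K f) = f.
Proof.
apply/setP => e; rewrite !inE; have [eD | eD] /= := boolP (e \in cover K).
  rewrite -[e]/(val (Sub e eD : darc (subgraph K))) mem_imset ?inE //.
  exact: val_inj.
by rewrite orb_idr // => /imsetP[w _ ew]; move: eD; rewrite ew (valP w).
Qed.

(** Factors of the collapsed digraph lift to [G] with the same number of cycles, which gives oddness
    and one direction of H-equivalence. For the other, a Hamiltonian cycle of [G] passes through a
    vertex outside [X], so it is open on the subgraph and its route there must be [r]. *)
Lemma collapse_correct (G : digraph) (K : {set {set darc G}})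
    (r : {ffun entry (subgraph K) -> exit (subgraph K)}) :
  K \subset ACs G -> odd_2dd G -> all_ACs_size6 G ->
  (exists v, v \notin sources (cover K)) -> unique_open_route r ->
  [/\ odd_2dd (collapse r), all_ACs_size6 (collapse r) & H_equivalent G (collapse r)].
Proof.
move=> KA [dd oddG] G6 [v vX] [/(open_routeE dd KA)[f [lf lp rP]] r_uniq].
have dd' := collapse_2dd dd KA lf lp rP.
have lE := local_collapse dd KA lf lp rP.
have K'A := complement_sub K.
have ext_local g h : local g -> @local (collapse r) h ->
    local (@extend G (ACs G :\: K) g h).
  by move=> lg /lE lh; apply: extend_local.
split; last split.
- split=> // h /(factor_local (dd_2digraph dd')) lh.
  rewrite num_cyclesE // (collapse_fcard dd KA lf lp rP) // -num_cyclesE //.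
    exact/oddG/local_factor/ext_local.
  exact: ext_local.
- exact: (collapse_size6 dd KA lf lp rP).
- move=> /(hamiltonianE dd)[|g [lg g1]]; first by apply/card_gt0P; exists v.
  have gcon := ((fcard1P (nxt_inj dd lg)).1 g1).2.
  have og : leaves (sources (cover K)) (nxt g).
    by move=> x; exists (findex (nxt g) x v); rewrite iter_findex.
  have [r' r'P] := exists_route dd KA lg og.
  have r'r : r' = r by apply: r_uniq; apply/open_routeE => //; exists g.
  rewrite r'r in r'P.
  have lh : @local (collapse r) (restr (ACs G :\: K) g) by apply/lE/restr_local.
  apply/(hamiltonianE dd'); last first.
    exists (restr (ACs G :\: K) g); split=> //.
    by rewrite (collapse_fcard dd KA lg og r'P) // extend_restr.
  have [psi _] := exists_leave_vert dd KA og.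
  by apply/card_gt0P; exists (glue_class _ (psi v)).
- have [psi _] := exists_leave_vert dd KA lp.
  move=> /(hamiltonianE dd')[|h [lh h1]].
    by apply/card_gt0P; exists (glue_class _ (psi v)).
  apply/(hamiltonianE dd); first by apply/card_gt0P; exists v.
  exists (@extend G (ACs G :\: K) f h); split; first exact: ext_local.
  by rewrite -(collapse_fcard dd KA lf lp rP).
Qed.

(** * Replacing by a single alternating cycle *)

Section Hexagon.
Variables (T U W : finType) (iU : U -> T) (iW : W -> T) (r : bool -> U -> W).
Hypotheses (iU_inj : injective iU) (iW_inj : injective iW).
Hypothesis cover_T : forall t, (t \in codom iU) || (t \in codom iW).
Hypothesis r_bij : forall b, bijective (r b).

(* One alternating cycle with routes r true and r false when |U| = 3 and the two differ
   everywhere: U and W index its start and end vertices, which iU and iW may identify. *)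
Definition hexagon : digraph :=
  @Digraph T (bool * U)%type (fun e => iU e.2) (fun e => iW (r e.1 e.2)).

Lemma hexagon_outdeg (t : vert hexagon) :
  outdeg t = if t \in codom iU then 2 else 0.
Proof.
case: ifPn => [/codomP[u ->] | nt].
  transitivity #|[set (true, u); (false, u)]|; last by rewrite cards2.
  apply: eq_card => -[b u']; rewrite !inE /= (inj_eq iU_inj) !xpair_eqE.
  by case: b; rewrite /= ?orbF.
apply: eq_card0 => -[b u]; rewrite inE /=; apply: contraNF nt => /eqP <-.
exact: codom_f.
Qed.

Lemma hexagon_indeg (t : vert hexagon) :
  indeg t = if t \in codom iW then 2 else 0.
Proof.
case: ifPn => [/codomP[w ->] | nt].
  have [rt Kt tK] := r_bij true; have [rf Kf fK] := r_bij false.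
  transitivity #|[set (true, rt w); (false, rf w)]|; last by rewrite cards2.
  apply: eq_card => -[b u']; rewrite !inE /= (inj_eq iW_inj) !xpair_eqE.
  by case: b => /=; rewrite ?orbF; [rewrite -{1}(tK w) | rewrite -{1}(fK w)];
    rewrite bij_eq.
apply: eq_card0 => -[b u]; rewrite inE /=; apply: contraNF nt => /eqP <-.
exact: codom_f.
Qed.

Lemma hexagon_2digraph : is_2digraph hexagon.
Proof.
move=> t; rewrite /is_entry /is_exit /is_saturated hexagon_outdeg hexagon_indeg.
by have := cover_T t; case: (t \in codom iU); case: (t \in codom iW).
Qed.

Lemma sib_hexagon (e e' : darc hexagon) :
  sib e e' = (e != e') && ((e.2 == e'.2) || (r e.1 e.2 == r e'.1 e'.2)).
Proof. by rewrite /sib /= (inj_eq iU_inj) (inj_eq iW_inj). Qed.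

Lemma hexagon_local b : @local hexagon [set e : bool * U | e.1 == b].
Proof.
move=> [c u] [c' u']; rewrite sib_hexagon !inE /= xpair_eqE.
case: (eqVneq c c') => [<-|].
  rewrite /= (inj_eq (bij_inj (r_bij c))) orbb => /andP[/negPf h].
  by rewrite h.
by case: b c c' => -[] [].
Qed.

Hypotheses (U3 : #|U| = 3) (r_neq : forall u, r true u != r false u).

(** Two sibling steps lead from [u] to [k u], where [k] is [r true] followed by the inverse of
    [r false]. As a permutation of three points without fixed points, [k] is a 3-cycle, so all arcs
    are connected. *)
Lemma hexagon_connect (e e' : darc hexagon) : connect sib e e'.
Proof.
have sym := @sib_connect_sym hexagon.
have flip b u : connect sib ((b, u) : darc hexagon) (~~ b, u).
  apply: connect1; rewrite sib_hexagon /= eqxx xpair_eqE.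
  by case: b.
have [rf Kf fK] := r_bij false; pose k u := rf (r true u).
have k_neq u : k u != u by apply: contraNneq (r_neq u) => ku; rewrite -[in X in _ == X]ku fK.
have kE u : connect sib ((true, u) : darc hexagon) (true, k u).
  apply: connect_trans (flip false _); apply: connect1.
  by rewrite sib_hexagon /= fK eqxx orbT.
have k_inj : injective k by apply: inj_comp (can_inj fK) (bij_inj (r_bij true)).
have two u v : connect sib ((true, u) : darc hexagon) (true, v).
  have [-> // | uv] := eqVneq u v.
  have [<- // | kuv] := eqVneq (k u) v.
  have uniq3 : [set u; v; k u] = [set: U].
    apply/eqP; rewrite eqEcard subsetT cardsT U3 -setUA cardsU1 cards2 !inE.
    by rewrite negb_or uv eq_sym k_neq eq_sym kuv.
  have : k v \in [set u; v; k u] by rewrite uniq3.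
  rewrite !inE (negPf (k_neq v)) orbF (inj_eq k_inj) [v == u]eq_sym (negPf uv) orbF.
  by move=> /eqP <-; rewrite sym.
have base b u : connect sib ((b, u) : darc hexagon) (true, u).
  by case: b => //; apply: flip.
case: e e' => [b u] [b' u']; apply: connect_trans (base b u) _.
by apply: connect_trans (two u u') _; rewrite sym.
Qed.

Lemma hexagon_ac_of (e : darc hexagon) : ac_of e = [set: darc hexagon].
Proof. by apply/setP => e'; rewrite !inE hexagon_connect. Qed.

Lemma card_hexagon_ac_of (e : darc hexagon) : #|ac_of e| = 6.
Proof. by rewrite hexagon_ac_of cardsT card_prod card_bool U3. Qed.

Lemma hexagon_single_AC : single_AC hexagon.
Proof.
split; first exact: hexagon_2digraph.
have [u _] : exists u : U, u \in U by apply/card_gt0P; rewrite U3.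
rewrite -(cards1 [set: darc hexagon]); congr #|pred_of_set _|; apply/setP => A.
rewrite [RHS]inE; apply/(ACsP hexagon_2digraph)/eqP => [[e ->] | ->].
  exact: hexagon_ac_of.
by exists (true, u); rewrite hexagon_ac_of.
Qed.

Lemma hexagon_localE (h : {set darc hexagon}) : @local hexagon h ->
  exists b, forall e : darc hexagon, (e \in h) = (e.1 == b).
Proof.
move=> lh; have [u _] : exists u : U, u \in U by apply/card_gt0P; rewrite U3.
exists ((true, u) \in h) => e.
have := @local_agree hexagon h [set e : bool * U | e.1 == ((true, u) \in h)] (true, u) e lh.
move=> ->; rewrite ?inE ?eqb_id //=; first exact: hexagon_local.
  exact: hexagon_connect.
Qed.

End Hexagon.

Section Replace.
Variables (G : digraph) (K : {set {set darc G}}) (F' : digraph).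
Variables (phi : exit (complement K) -> entry F') (psi : exit F' -> entry (complement K)).
Hypotheses (phi_bij : bijective phi) (psi_bij : bijective psi).
Hypotheses (dd : is_2dd G) (F'2 : is_2digraph F').
Notation H := (complement K).
Let U := disjoint_union H F'.

(** The gluing relation of [replace]; both of its parts are oriented from exits to entries, as the
    results on [glue] require. *)
Definition replace_rel (x y : vert U) :=
  [exists u, (x == inl (val u)) && (y == inr (val (phi u)))] ||
  [exists w, (x == inr (val w)) && (y == inl (val (psi w)))].

Lemma replace_relP x y : replace_rel x y <->
  (exists u, x = inl (val u) /\ y = inr (val (phi u))) \/
  (exists w, x = inr (val w) /\ y = inl (val (psi w))).
Proof.
split=> [/orP[]/existsP[u /andP[/eqP-> /eqP->]] | [][u [-> ->]]].
- by left; exists u.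
- by right; exists u.
- by apply/orP; left; apply/existsP; exists u; rewrite !eqxx.
- by apply/orP; right; apply/existsP; exists u; rewrite !eqxx.
Qed.

Lemma is_entry_inl (x : vert H) : @is_entry U (inl x) = is_entry x.
Proof. by rewrite /is_entry; have [-> ->] := @degree_inl H F' x. Qed.
Lemma is_exit_inl (x : vert H) : @is_exit U (inl x) = is_exit x.
Proof. by rewrite /is_exit; have [-> ->] := @degree_inl H F' x. Qed.
Lemma is_entry_inr (x : vert F') : @is_entry U (inr x) = is_entry x.
Proof. by rewrite /is_entry; have [-> ->] := @degree_inr H F' x. Qed.
Lemma is_exit_inr (x : vert F') : @is_exit U (inr x) = is_exit x.
Proof. by rewrite /is_exit; have [-> ->] := @degree_inr H F' x. Qed.

Lemma replace_ee x y : replace_rel x y -> is_exit x /\ is_entry y.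
Proof.
move=> /replace_relP[][u [-> ->]].
  by rewrite is_exit_inl is_entry_inr (valP u) (valP (phi u)).
by rewrite is_exit_inr is_entry_inl (valP u) (valP (psi u)).
Qed.

Lemma replace_fun x y y' : replace_rel x y -> replace_rel x y' -> y = y'.
Proof.
by move=> /replace_relP[][u [-> ->]] /replace_relP[][w [] // [] /val_inj <- ->].
Qed.

Lemma replace_inj x x' y : replace_rel x y -> replace_rel x' y -> x = x'.
Proof.
move=> /replace_relP[][u [-> ->]] /replace_relP[][w [-> [] //]] /val_inj.
  by move=> /(bij_inj phi_bij) ->.
by move=> /(bij_inj psi_bij) ->.
Qed.

Lemma replace_exit x : is_exit x -> exists y, replace_rel x y.
Proof.
case: x => x; rewrite ?is_exit_inl ?is_exit_inr => xe.
  exists (inr (val (phi (Sub x xe)))); apply/replace_relP; left.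
  by exists (Sub x xe).
exists (inl (val (psi (Sub x xe)))); apply/replace_relP; right.
by exists (Sub x xe).
Qed.

Lemma replace_entry y : is_entry y -> exists x, replace_rel x y.
Proof.
case: y => y; rewrite ?is_entry_inl ?is_entry_inr => ye.
  have [psi' _ psiK] := psi_bij; exists (inr (val (psi' (Sub y ye)))).
  by apply/replace_relP; right; exists (psi' (Sub y ye)); rewrite psiK.
have [phi' _ phiK] := phi_bij; exists (inl (val (phi' (Sub y ye)))).
by apply/replace_relP; left; exists (phi' (Sub y ye)); rewrite phiK.
Qed.

Let H2 := @complement_2digraph G dd K.

Lemma replace_2dd : is_2dd (replace phi psi).
Proof.
have U2 : is_2digraph U by apply: union_2digraph.
exact (glue_2dd U2 replace_ee replace_fun replace_inj replace_exit replace_entry).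
Qed.

Lemma local_replace (h : {set darc U}) : @local (replace phi psi) h <-> @local U h.
Proof. exact: (local_glue replace_ee replace_fun replace_inj). Qed.

Lemma replace_size6 : all_ACs_size6 G -> (forall e : darc F', #|ac_of e| = 6) ->
  all_ACs_size6 (replace phi psi).
Proof.
move=> /(all_ACs_size6P (dd_2digraph dd)) G6 F6.
apply/(all_ACs_size6P (dd_2digraph replace_2dd)) => e.
rewrite (card_ac_of_glue replace_ee replace_fun replace_inj).
case: e => e; last by rewrite card_ac_of_inr.
by rewrite card_ac_of_inl (card_ac_of_induced (cover_closed dd (complement_sub K))) G6.
Qed.

Lemma local_union (h : {set darc U}) : @local U h <->
  local [set e : darc H | inl e \in h] /\ local [set e : darc F' | inr e \in h].
Proof.
split=> [lh | [lh lh'] [x | x] [y | y] // s].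
- by split=> x y xy; rewrite !inE; apply: lh; rewrite ?sib_inl ?sib_inr.
- by have := lh x y s; rewrite !inE.
- by have := lh' x y s; rewrite !inE.
Qed.

Lemma glue_phi u : 
  glue_class replace_rel (inl (val u)) = glue_class replace_rel (inr (val (phi u))).
Proof.
apply/eqP; rewrite (glue_classE replace_ee replace_fun replace_inj).
by apply/or3P; constructor 2; apply/replace_relP; left; exists u.
Qed.

Lemma glue_psi w : 
  glue_class replace_rel (inr (val w)) = glue_class replace_rel (inl (val (psi w))).
Proof.
apply/eqP; rewrite (glue_classE replace_ee replace_fun replace_inj).
by apply/or3P; constructor 2; apply/replace_relP; right; exists w.
Qed.

End Replace.

Lemma card_sig_image (T : finType) (P : pred T) (V : finType) (i : T -> V) (B : {set V}) :
  injective i -> (forall x, P x = (i x \in B)) -> (forall v, v \in B -> v \in codom i) ->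
  #|{: {x | P x}}| = #|B|.
Proof.
move=> inji PB cB; rewrite card_sig -(card_image inji); apply: eq_card => v.
apply/imageP/idP => [[x + ->] | vB]; first by rewrite unfold_in PB.
by have /codomP[x vx] := cB _ vB; exists x; rewrite // unfold_in PB -vx.
Qed.

Section HexagonReplace.
Variables (G : digraph) (dd : is_2dd G) (K : {set {set darc G}}).
Hypothesis KA : K \subset ACs G.
Notation D := (cover K).
Notation X := (sources D).
Notation Y := (targets D).
Notation K' := (ACs G :\: K).
Notation H := (complement K).
Notation U := (exit H).
Notation W := (entry H).

Lemma card_exit_subgraph : #|exit (subgraph K)| = #|Y :\: X|.
Proof.
apply: (@card_sig_image _ _ _ val); first exact: val_inj.
  by move=> x; rewrite is_exit_induced //; apply: cover_closed.
move=> v; rewrite inE => /andP[_ vX].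
have vF : v \in endpoints D by rewrite mem_endpoints vX orbT.
by apply/codomP; exists (Sub v vF).
Qed.

Lemma card_exit_complement : #|U| = #|X :\: Y|.
Proof.
apply: (@card_sig_image _ _ _ val); first exact: val_inj.
  by move=> x; rewrite is_exit_complement.
move=> v; rewrite inE => /andP[vY _].
have vF : v \in endpoints (cover K') by rewrite complement_vert // inE (negPf vY) andbF.
by apply/codomP; exists (Sub v vF).
Qed.

Lemma card_entry_complement : #|W| = #|Y :\: X|.
Proof.
apply: (@card_sig_image _ _ _ val); first exact: val_inj.
  by move=> x; rewrite is_entry_complement.
move=> v; rewrite inE => /andP[vX _].
have vF : v \in endpoints (cover K') by rewrite complement_vert // inE (negPf vX).
by apply/codomP; exists (Sub v vF).
Qed.

Lemma card_entry_exit : #|X :\: Y| = #|Y :\: X|.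
Proof.
have [f lf] := exists_local (dd_2digraph dd).
have eq_XY : #|X| = #|Y| by rewrite -(nxt_sources dd KA lf) card_imset //; apply: nxt_inj.
by rewrite !cardsD eq_XY setIC.
Qed.

Variables (f : bool -> {set darc G}) (lf : forall b, local (f b)).
Hypothesis lp : forall b, leaves X (nxt (f b)).
Variable r : bool -> U -> W.
Hypothesis rP : forall b u, val (val (r b u)) = leave X (nxt (f b)) (val (val u)).

Lemma route_bij b : bijective (r b).
Proof.
apply: inj_card_bij.
  move=> u u' /(congr1 (val \o val)) /=; rewrite !rP.
  have UY (w : U) : val (val w) \in [predC nxt (f b) @: X].
    have := valP w; rewrite is_exit_complement // inE => /andP[wY _].
    by rewrite inE /= (nxt_sources dd KA (lf b)).
  by move=> /(leave_inj (nxt_inj dd (lf b)) (lp b)) e; apply/val_inj/val_inj/e.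
by rewrite card_entry_complement card_exit_complement card_entry_exit.
Qed.

(** Start and end vertices are kept apart here, so that this alternating cycle has no saturated
    vertex: its entries are indexed by the exits of the complement and its exits by the entries of
    the complement. *)
Let F' : digraph := hexagon (@inl U W) (@inr U W) r.

Lemma sum_cover (t : U + W) : (t \in codom inl) || (t \in codom inr).
Proof. by case: t => t; rewrite codom_f ?orbT. Qed.

Lemma inl_notin_codom (u : U) : ((inl u : U + W) \in codom inr) = false.
Proof. by apply/codomP => -[]. Qed.

Lemma inr_notin_codom (w : W) : ((inr w : U + W) \in codom inl) = false.
Proof. by apply/codomP => -[]. Qed.

Let outdegF := @hexagon_outdeg (U + W)%type U W inl inr r (@inl_inj _ _).
Let indegF := @hexagon_indeg (U + W)%type U W inl inr r (@inr_inj _ _) route_bij.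
Let F'2 : is_2digraph F' :=
  @hexagon_2digraph (U + W)%type U W inl inr r (@inl_inj _ _) (@inr_inj _ _) sum_cover route_bij.

Lemma is_entry_hexagon (t : vert F') : is_entry t = (t \in codom inl).
Proof.
rewrite /is_entry outdegF indegF; case: t => t.
  by rewrite inl_notin_codom codom_f.
by rewrite inr_notin_codom codom_f.
Qed.

Lemma is_exit_hexagon (t : vert F') : is_exit t = (t \in codom inr).
Proof.
rewrite /is_exit outdegF indegF; case: t => t.
  by rewrite inl_notin_codom codom_f.
by rewrite inr_notin_codom codom_f.
Qed.

Lemma exists_phi : exists phi : U -> entry F',
  bijective phi /\ forall u, val (phi u) = inl u.
Proof.
have /fin_all_exists[phi phiP] : forall u : U, exists t : entry F', val t = inl u.
  move=> u; have ue : is_entry (inl u : vert F') by rewrite is_entry_hexagon codom_f.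
  by exists (Sub (inl u : vert F') ue).
exists phi; split=> //; apply: inj_card_bij.
  by move=> u u' /(congr1 val); rewrite !phiP => -[].
rewrite (@card_sig_image _ _ _ id [set t | t \in codom inl]) //=.
- by rewrite cardsE card_codom //; apply: inl_inj.
- by move=> t; rewrite inE is_entry_hexagon.
- by move=> t _; apply/codomP; exists t.
Qed.

Lemma exists_psi : exists psi : exit F' -> W,
  bijective psi /\ forall w, val w = inr (psi w).
Proof.
have /fin_all_exists[psi psiP] : forall w : exit F', exists t : W, val w = inr t.
  by move=> w; have := valP w; rewrite is_exit_hexagon => /codomP.
exists psi; split=> //; apply: inj_card_bij.
  by move=> w w' e; apply: val_inj; rewrite !psiP e.
rewrite [X in _ <= X](@card_sig_image _ _ _ id [set t | t \in codom inr]) //=.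
- by rewrite cardsE card_codom //; apply: inr_inj.
- by move=> t; rewrite inE is_exit_hexagon.
- by move=> t _; apply/codomP; exists t.
Qed.

Variables (phi : U -> entry F') (psi : exit F' -> W).
Hypotheses (phi_bij : bijective phi) (psi_bij : bijective psi).
Hypotheses (phiP : forall u, val (phi u) = inl u) (psiP : forall w, val w = inr (psi w)).
Notation G' := (replace phi psi).
Notation class := (glue_class (replace_rel phi psi)).
Let dd' : is_2dd G' := replace_2dd phi_bij psi_bij dd F'2.

(** The vertex of [G] for which [x] stands; glued vertices have the same value. *)
Let pos (x : vert (disjoint_union H F')) : vert G :=
  match x with inl t => val t | inr (inl u) => val (val u) | inr (inr w) => val (val w) end.

(* b selects the open factor of the subgraph that has the route used by f'. *)
Lemma replace_fcard (f' : {set darc G'}) b : @local G' f' ->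
  (forall e : darc F', (inr e \in f') = (e.1 == b)) ->
  fcard (nxt f') (vert G') =
  fcard (nxt (@extend G K' (f b) [set e | inl e \in f'])) (vert G).
Proof.
move=> lf' f'b; set h := [set e | _].
have lh : local h.
  by have /local_replace/local_union[] := lf'.
have K'A := complement_sub K.
set g := extend (f b) h; have lg : local g := extend_local dd K'A (lf b) lh.
have gX e : e \in D -> (e \in g) = (e \in f b).
  move=> eD; rewrite !inE mem_cover_complement // eD /= orb_idr // => /imsetP[w _ ew].
  have: e \in cover K' by rewrite ew; apply: (valP w).
  by rewrite mem_cover_complement // eD.
have [og leaveE] : leaves X (nxt g) /\ leave X (nxt (f b)) =1 leave X (nxt g).
  apply: leave_eq => // v vX; have [e ef ev] := local_out dd v (lf b).
  have eg : e \in g by rewrite gX // -(mem_cover_src dd KA) ev.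
  by rewrite -ev !nxtE.
have [back backP] := exists_leave_vert dd KA (lp b).
have arc_step (e : darc G') : e \in f' -> fconnect (nxt f') (src e) (tgt e).
  by move=> ef; rewrite -(nxtE (G := G') lf' ef); apply: fconnect1.
have phiE u : class (inl (val u)) = class (inr (inl u)).
  by rewrite (glue_phi phi_bij psi_bij) phiP.
have psiE w : class (inr (inr w)) = class (inl (val w)).
  have [psi' _ psiK] := psi_bij.
  have -> : (inr w : vert F') = val (psi' w) by rewrite psiP psiK.
  by rewrite (glue_psi phi_bij psi_bij) psiK.
have connV t : fconnect (nxt f') (class (inl t)) (class (inl (back (val t)))).
  have [tX | tX] := boolP (val t \in X); last first.
    rewrite (_ : back (val t) = t) ?connect0 //.
    by apply: val_inj; rewrite backP leave_out.
  have te : is_exit t.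
    rewrite is_exit_complement // inE tX andbT.
    by have := valP t; rewrite complement_vert // inE tX.
  pose u : U := Sub t te.
  have -> : class (inl t) = class (inr (inl u)) by rewrite -phiE.
  have -> : back (val t) = val (r b u) by apply: val_inj; rewrite backP rP.
  (* The single arc [(b, u)] of the new alternating cycle does the work of the whole path of [f b]
     through the subgraph. *)
  by rewrite -psiE; apply: (arc_step (inr (b, u))); rewrite f'b.
have stepV v : fconnect (nxt f') (class (inl (back v))) (class (inl (back (nxt g v)))).
  have [vX | vX] := boolP (v \in X).
    have -> : back v = back (nxt g v); last exact: connect0.
    by apply: val_inj; rewrite !backP !leaveE leave_step.
  have [e eg ev] := local_out dd v lg.
  have eD : e \in cover K'.
    by rewrite mem_cover_complement // -(mem_cover_src dd KA) ev.
  pose e' : darc H := Sub e eD.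
  have e'h : inl e' \in f'.
    have: e' \in h by rewrite -(mem_extend (f b)).
    by rewrite inE.
  have -> : back v = src e'.
    by apply: val_inj; rewrite backP leave_out //= ev.
  apply: connect_trans (arc_step _ e'h) _.
  have -> : nxt g v = val (tgt e') by rewrite -ev nxtE.
  exact: connV.
have classV x : fconnect (nxt f') (class x) (class (inl (back (pos x)))).
  case: x => [t | [u | w]]; first exact: connV.
    by rewrite -phiE; apply: connV.
  by rewrite psiE; apply: connV.
symmetry; apply: (glue_fcard dd lg dd' lf' (phi := pos) (psi := inl \o back)).
- move=> x y /replace_relP[][w [-> ->]] /=.
    by rewrite phiP connect0.
  by rewrite psiP connect0.
- case=> [e | [c u]] ef /=.
    apply: (@connect_trans _ _ (nxt g (val (src e)))); first exact: fconnect1.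
    by rewrite nxtE ?mem_extend ?inE // connect0.
  move: ef; rewrite f'b /= => /eqP ->.
  by rewrite rP leaveE; apply: leave_fconnect.
- by move=> v /=; rewrite backP leaveE; apply: leave_fconnect.
- exact: stepV.
- exact: classV.
Qed.

End HexagonReplace.

(** * Parity constraints on open routes *)

Lemma odd_fcard (G : digraph) (f : {set darc G}) :
  odd_2dd G -> local f -> odd (fcard (nxt f) (vert G)).
Proof. by move=> [dd oddG] lf; rewrite -num_cyclesE //; apply/oddG/local_factor. Qed.

Section Routes.
Variables (G : digraph) (K : {set {set darc G}}).
Hypotheses (KA : K \subset ACs G) (Godd : odd_2dd G).
Notation D := (cover K).
Notation X := (sources D).
Notation Y := (targets D).
Let dd : is_2dd G := Godd.1.

(** If the two routes differed at [x], they would differ by exchanging the values at [x] and [y].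
    Then [f] and [splice K f g], equal outside the subgraph, would have return maps differing by a
    transposition, against the oddness of both numbers of cycles. *)
Lemma open_route_no_swap f g x y :
  local f -> local g -> leaves X (nxt f) -> leaves X (nxt g) ->
  x \in X :\: Y -> y \in X :\: Y -> x != y ->
  {in X :\: Y, forall u, u != x -> u != y -> leave X (nxt f) u = leave X (nxt g) u} ->
  leave X (nxt f) x = leave X (nxt g) x.
Proof.
move=> lf lg lvf og xXY yXY xy others; apply: contraTeq isT => neq_x.
have YE h : local h -> nxt h @: X = Y by apply: nxt_sources.
have injL h : local h -> leaves X (nxt h) -> {in X :\: Y &, injective (leave X (nxt h))}.
  move=> lh oh u v; rewrite !in_setD -!(YE _ lh) => /andP[uY _] /andP[vY _].
  by apply: leave_inj; rewrite ?inE //; apply: nxt_inj.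
have ontoL z : z \in X :\: Y -> exists2 u, u \in X :\: Y &
    leave X (nxt g) z = leave X (nxt f) u.
  move=> zXY; have : leave X (nxt g) z \in leave X (nxt f) @: (X :\: Y).
    rewrite -(YE _ lf) leave_onto //; last exact: nxt_inj.
    by rewrite (YE _ lf) leave_targets.
  by case/imsetP=> u uXY e; exists u.
(* Both routes are bijections onto [Y :\: X] that agree off [x] and [y]; disagreeing at [x], they
   must swap the two remaining values. *)
have gx : leave X (nxt g) x = leave X (nxt f) y.
  have [z zXY gz] := ontoL x xXY; rewrite gz.
  have [-> // | zy] := eqVneq z y; have [zx | zx] := eqVneq z x.
    by rewrite gz zx eqxx in neq_x.
  by move: gz; rewrite others // => /(injL g lg og) e; rewrite e ?eqxx in zx.
have gy : leave X (nxt g) y = leave X (nxt f) x.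
  have [z zXY gz] := ontoL y yXY; rewrite gz.
  have [-> // | zx] := eqVneq z x; have [zy | zy] := eqVneq z y.
    move: gz; rewrite zy -gx => /(injL g lg og) e.
    by rewrite e ?eqxx in xy.
  by move: gz; rewrite others // => /(injL g lg og) e; rewrite e ?eqxx in zy.
have [oh leaveE] := splice_leaves dd KA lf lg og.
have lh := splice_local dd KA lf lg.
have := @odd_fcard_swap _ X (nxt f) (nxt (splice K f g)) x y.
rewrite !odd_fcard // YE // => -> //; try exact: nxt_inj.
- by move=> v; rewrite inE => vX; rewrite nxt_splice // (negPf vX).
- by move: xXY; rewrite inE => /andP[].
- by move: yXY; rewrite inE => /andP[].
move=> v; rewrite inE => vY; rewrite -leaveE.
have [-> // | vx] := eqVneq v x; first by rewrite tpermL.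
have [-> // | vy] := eqVneq v y; first by rewrite tpermR.
rewrite tpermD 1?eq_sym //; have [vX | vX] := boolP (v \in X).
  by rewrite others // inE vX vY.
by rewrite !leave_out.
Qed.

End Routes.

Section TwoRoutes.
Variables (G : digraph) (K : {set {set darc G}}).
Hypotheses (KA : K \subset ACs G) (Godd : odd_2dd G).
Notation D := (cover K).
Notation X := (sources D).
Notation Y := (targets D).
Notation K' := (ACs G :\: K).
Let dd : is_2dd G := Godd.1.
Variable f : bool -> {set darc G}.
Hypotheses (XY3 : #|X :\: Y| = 3) (lf : forall b, local (f b)).
Hypothesis lp : forall b, leaves X (nxt (f b)).
Hypothesis f_neq :
  {in X :\: Y, forall u, leave X (nxt (f true)) u != leave X (nxt (f false)) u}.

(** Replacing the part of [g] inside the subgraph by [f true] or [f false] gives factors all of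
    whose cycles meet the three entries, hence with one or three cycles. Three cycles in both would
    force each path to return to the entry it came from along the common outside part, so the two
    routes would coincide. *)
Lemma hamiltonian_switch g : local g -> fcard (nxt g) (vert G) = 1 ->
  exists b, fcard (nxt (splice K g (f b))) (vert G) = 1.
Proof.
move=> lg g1; have gcon := ((fcard1P (nxt_inj dd lg)).1 g1).2.
pose k b := splice K g (f b).
have lk b : local (k b) := splice_local dd KA lg (lf b).
have ok b : leaves X (nxt (k b)) by case: (splice_leaves dd KA lg (lf b) (lp b)).
have leaveE b : leave X (nxt (f b)) =1 leave X (nxt (k b)).
  by case: (splice_leaves dd KA lg (lf b) (lp b)).
(* Outside X the factors k true and k false both follow g, whose single cycle
   leads back to an entry vertex of the subgraph. *)
have back v : v \notin X ->
    exists2 u, u \in X :\: Y & forall b, fconnect (nxt (k b)) v u.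
  move=> vX; have [z] : exists z, z \in X :\: Y by apply/card_gt0P; rewrite XY3.
  rewrite inE => /andP[_ zX].
  have lX : leaves (~: X) (nxt g).
    move=> x; exists (findex (nxt g) x z); rewrite iter_findex //.
    by rewrite inE negbK.
  have agree b : {in ~: X, nxt g =1 nxt (k b)}.
    by move=> x; rewrite inE => xX; rewrite nxt_splice // (negPf xX).
  exists (leave (~: X) (nxt g) v).
    have := leave_notin v lX; rewrite !inE negbK => -> /=; rewrite andbT.
    have := @leave_in _ (~: X) (nxt g) v lX; rewrite inE vX => /(_ isT).
    by case/imsetP=> x; rewrite inE => xX ->; rewrite nxt_targets.
  move=> b; have [lX' ->] := leave_eq lX (agree b).
  exact: leave_fconnect.
have meet b v : exists2 u, u \in X :\: Y & fconnect (nxt (k b)) v u.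
  have [u uXY uP] := back _ (leave_notin v (ok b)); exists u => //.
  exact: connect_trans (leave_fconnect v (ok b)) (uP b).
have disj b := fcard_meet3 (nxt_inj dd (lk b)) XY3 (meet b) (odd_fcard Godd (lk b)).
case: (disj true) => [| dT]; first by exists true.
case: (disj false) => [| dF]; first by exists false.
(* From the exit [w] of [u] under [k true], both factors lead to the same entry [u'], and separation
   of the entries gives [u' = u]. The entry [z] with exit [w] under [k false] is then also [u], so
   the routes agree at [u]. *)
have [u uXY] : exists u, u \in X :\: Y by apply/card_gt0P; rewrite XY3.
case/negP: (f_neq uXY); rewrite !leaveE.
set w := leave X (nxt (k true)) u.
have wX : w \notin X by apply: leave_notin.
have uw : fconnect (nxt (k true)) u w by apply: leave_fconnect.
have [u' u'XY u'P] := back w wX.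
have uu' : u = u' by apply: dT => //; apply: connect_trans uw (u'P true).
have: w \in leave X (nxt (k false)) @: (X :\: Y).
  rewrite -(nxt_sources dd KA (lk false)) leave_onto //; last exact: nxt_inj.
  by rewrite (nxt_sources dd KA (lk false)) leave_targets.
case/imsetP=> z zXY wz; rewrite wz; apply/eqP; congr (leave _ _ _).
apply: dF => //; rewrite uu'; apply: connect_trans (u'P false); rewrite wz.
exact: leave_fconnect.
Qed.

Lemma exists_complement_route b :
  exists r : exit (complement K) -> entry (complement K),
    forall u, val (val (r u)) = leave X (nxt (f b)) (val (val u)).
Proof.
apply: (@fin_all_exists _ _ (fun u w => val (val w) = _)) => u.
have := valP u; rewrite is_exit_complement // => /(leave_targets dd KA (lf b) (lp b)) wYX.
have [back backP] := exists_leave_vert dd KA (lp b).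
have we : is_entry (back (val (val u))) by rewrite is_entry_complement // backP.
by exists (Sub (back (val (val u))) we); rewrite /= backP.
Qed.

Variable r : bool -> exit (complement K) -> entry (complement K).
Hypothesis rP : forall b u, val (val (r b u)) = leave X (nxt (f b)) (val (val u)).
Let rbij := route_bij dd KA lf lp rP.
Let F' := hexagon inl inr r.
Variables (phi : exit (complement K) -> entry F') (psi : exit F' -> entry (complement K)).
Hypotheses (phi_bij : bijective phi) (psi_bij : bijective psi).
Hypotheses (phiP : forall u, val (phi u) = inl u) (psiP : forall w, val w = inr (psi w)).
Notation G' := (replace phi psi).

Let U3 : #|exit (complement K)| = 3. Proof. by rewrite card_exit_complement. Qed.

Let r_neq u : r true u != r false u.
Proof.
have := valP u; rewrite is_exit_complement // => /f_neq.
by apply: contraNneq => ruE; rewrite -!rP ruE.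
Qed.

Let F'2 : is_2digraph F' :=
  hexagon_2digraph (@inl_inj _ _) (@inr_inj _ _) (@sum_cover G K) rbij.

Let dd' : is_2dd G' := replace_2dd phi_bij psi_bij dd F'2.

Lemma replace_factor (h : {set darc G'}) : local h ->
  exists g, local g /\ fcard (nxt h) (vert G') = fcard (nxt g) (vert G).
Proof.
move=> lh; have /(local_replace phi_bij psi_bij)/local_union[lh1 lh2] := lh.
have [b hb] := hexagon_localE (@inl_inj _ _) (@inr_inj _ _) rbij U3 r_neq lh2.
exists (@extend G K' (f b) [set e | inl e \in h]).
split; first exact: (extend_local dd (complement_sub K)).
apply: (replace_fcard dd KA lf lp rP phi_bij psi_bij phiP psiP lh) => e.
by rewrite -hb inE.
Qed.

Lemma splice_factor g b : local g ->
  exists h : {set darc G'}, local h /\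
    fcard (nxt h) (vert G') = fcard (nxt (splice K g (f b))) (vert G).
Proof.
move=> lg.
pose h : {set darc G'} :=
  [set e | match e with inl e => val e \in g | inr e => e.1 == b end].
have lh : local h.
  apply/(local_replace phi_bij psi_bij)/local_union; split.
    by move=> x y xy; rewrite !inE; apply: lg.
  have l := @hexagon_local _ _ _ inl inr r (@inl_inj _ _) (@inr_inj _ _) rbij b.
  by move=> x y xy; have := l x y xy; rewrite !inE.
exists h; split=> [//|].
have hb (e : darc F') : (inr e \in h) = (e.1 == b) by rewrite inE.
rewrite (replace_fcard dd KA lf lp rP phi_bij psi_bij phiP psiP lh hb).
suff -> : @extend G K' (f b) [set e | inl e \in h] = splice K g (f b) by [].
have -> : [set e | inl e \in h] = restr K' g by apply/setP => e; rewrite !inE.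
apply/setP => e; rewrite mem_splice !inE mem_cover_complement // negbK andbC.
have [eD | eD] /= := boolP (e \in D).
  rewrite andbT orb_idr // => /imsetP[w _ ew].
  have: e \in cover K' by rewrite ew; apply: (valP w).
  by rewrite mem_cover_complement // eD.
have eD' : e \in cover K' by rewrite mem_cover_complement.
rewrite -[e]/(val (Sub e eD' : darc (complement K))) mem_imset ?inE //.
  by rewrite andbF.
exact: val_inj.
Qed.

Lemma replace_correct : all_ACs_size6 G ->
  [/\ odd_2dd G', all_ACs_size6 G' & H_equivalent G G'].
Proof.
move=> G6; have G0 : 0 < #|vert G|.
  have [v _] : exists v, v \in X :\: Y by apply/card_gt0P; rewrite XY3.
  by apply/card_gt0P; exists v.
have G'0 : 0 < #|vert G'|.
  have [u _] : exists u : exit (complement K), u \in predT by apply/card_gt0P; rewrite U3.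
  by apply/card_gt0P; exists (glue_class (replace_rel phi psi) (inl (val u))).
split.
- split; first exact: dd'.
  move=> h /(factor_local (dd_2digraph dd')) lh.
  have [g [lg hg]] := replace_factor lh.
  rewrite (num_cyclesE dd' lh) hg; exact: odd_fcard.
- apply: (replace_size6 phi_bij psi_bij dd F'2 G6) => e.
  exact: (card_hexagon_ac_of (@inl_inj _ _) (@inr_inj _ _) rbij U3 r_neq).
split.
- move=> /(hamiltonianE dd G0)[g [lg g1]]; have [b b1] := hamiltonian_switch lg g1.
  have [h [lh hE]] := splice_factor b lg.
  by apply/(hamiltonianE dd' G'0); exists h; rewrite hE.
- move=> /(hamiltonianE dd' G'0)[h [lh h1]].
  have [g [lg hg]] := replace_factor lh.
  by apply/(hamiltonianE dd G0); exists g; rewrite -hg.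
Qed.

End TwoRoutes.

Definition replaceable (G : digraph) (K : {set {set darc G}}) : Prop :=
  exists (F' : digraph) (phi : exit (complement K) -> entry F')
         (psi : exit F' -> entry (complement K)),
    [/\ single_AC F', #|exit F'| = #|exit (subgraph K)|, bijective phi, bijective psi
      & [/\ odd_2dd (replace phi psi), all_ACs_size6 (replace phi psi)
          & H_equivalent G (replace phi psi)]].

Lemma hexagon_replacement (G : digraph) (K : {set {set darc G}}) (f : bool -> {set darc G})
    (X := sources (cover K)) (Y := targets (cover K)) :
  K \subset ACs G -> odd_2dd G -> all_ACs_size6 G -> #|X :\: Y| = 3 ->
  (forall b, local (f b)) -> (forall b, leaves X (nxt (f b))) ->
  {in X :\: Y, forall u, leave X (nxt (f true)) u != leave X (nxt (f false)) u} ->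
  replaceable K.
Proof.
move=> KA Godd G6 XY3 lf lp f_neq; have dd := Godd.1.
have /fin_all_exists[r rP] := exists_complement_route KA Godd lf lp.
have rbij := route_bij dd KA lf lp rP.
have [phi [phi_bij phiP]] := exists_phi dd KA lf lp rP.
have [psi [psi_bij psiP]] := exists_psi dd KA lf lp rP.
exists (hexagon inl inr r), phi, psi; split.
- have U3 : #|exit (complement K)| = 3 by rewrite card_exit_complement.
  apply: (hexagon_single_AC (@inl_inj _ _) (@inr_inj _ _) (@sum_cover G K) rbij) => // u.
  have := valP u; rewrite is_exit_complement // => /f_neq.
  by apply: contraNneq => ruE; rewrite -!rP ruE.
- by rewrite (bij_eq_card psi_bij) card_entry_complement // card_exit_subgraph.
- exact: phi_bij.
- exact: psi_bij.
- exact: (replace_correct KA Godd XY3 lf lp f_neq rP phi_bij psi_bij phiP psiP G6).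
Qed.

(** * Two hexagons *)

(** For the cycle [e0, ..., e5] the lists hold the start and end vertices of [e0], [e2], [e4]. A
    factor containing [e0] follows these arcs and keeps the index [k]; otherwise it follows the odd
    arcs and moves to [k - 1], written [k + 2] modulo 3. *)
Lemma ac_coordinates (G : digraph) (A : {set darc G}) :
  is_2dd G -> A \in ACs G -> #|A| = 6 ->
  exists a xs ys,
    [/\ a \in A, [/\ size xs = 3, uniq xs & sources A =i xs],
        [/\ size ys = 3, uniq ys & targets A =i ys]
      & forall f v0 k, local f -> k < 3 ->
          nxt f (nth v0 xs k) = nth v0 ys ((k + (a \notin f).*2) %% 3)].
Proof.
move=> dd AA n6.
have [[s s6] /andP[/and4P[_ _ us /forallP alt] /eqP AE]] :
    exists t : 6.-tuple (darc G), alt_cycle t && (A == [set e in t]).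
  by case: _ / n6; move: AA; rewrite inE => /existsP.
case: s s6 us alt AE => [|e0 [|e1 [|e2 [|e3 [|e4 [|e5 []]]]]]] // s6 us alt AE.
have h0 : tgt e0 = tgt e1 by apply/eqP/(alt (@Ordinal 6 0 isT)).
have h1 : src e1 = src e2 by apply/eqP/(alt (@Ordinal 6 1 isT)).
have h2 : tgt e2 = tgt e3 by apply/eqP/(alt (@Ordinal 6 2 isT)).
have h3 : src e3 = src e4 by apply/eqP/(alt (@Ordinal 6 3 isT)).
have h4 : tgt e4 = tgt e5 by apply/eqP/(alt (@Ordinal 6 4 isT)).
have h5 : src e5 = src e0 by apply/eqP/(alt (@Ordinal 6 5 isT)).
have dd2 := dd_2digraph dd.
have sNeq (x y z : darc G) : x != y -> x != z -> y != z -> src x = src y -> src x != src z.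
  by move=> xy xz yz e; apply: contra_neq yz => /(mate_eq (src_fiber dd2) xy xz e).
have tNeq (x y z : darc G) : x != y -> x != z -> y != z -> tgt x = tgt y -> tgt x != tgt z.
  by move=> xy xz yz e; apply: contra_neq yz => /(mate_eq (tgt_fiber dd2) xy xz e).
move: us; rewrite /= !inE !negb_or.
case/and5P => /and5P[n01 n02 n03 n04 n05] /and4P[n12 n13 n14 n15].
move=> /and3P[n23 n24 n25] /andP[n34 n35] /andP[n45 _].
exists e0, [:: src e0; src e2; src e4], [:: tgt e0; tgt e2; tgt e4]; split.
- by rewrite AE !inE eqxx.
- split=> //.
    rewrite /= !inE negb_or andbT -andbA; apply/and3P; split.
    + by apply: (sNeq _ e5) => //; rewrite eq_sym.
    + by apply: (sNeq _ e5) => //; rewrite eq_sym.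
    + by apply: (sNeq _ e1) => //; rewrite eq_sym.
  move=> v; apply/imsetP/idP => [[e + ->] | ].
    rewrite AE !inE => /or4P[/eqP->|/eqP->|/eqP->|/or3P[]/eqP->];
    rewrite ?h1 ?h3 ?h5 ?eqxx ?orbT //.
  rewrite !inE => /or3P[]/eqP->; [exists e0 | exists e2 | exists e4] => //;
  by rewrite AE !inE eqxx ?orbT.
- split=> //.
    rewrite /= !inE negb_or andbT -andbA; apply/and3P; split.
    + by apply: (tNeq _ e1).
    + by apply: (tNeq _ e1).
    + by apply: (tNeq _ e3).
  move=> v; apply/imsetP/idP => [[e + ->] | ].
    rewrite AE !inE => /or4P[/eqP->|/eqP->|/eqP->|/or3P[]/eqP->];
    rewrite -?h0 -?h2 -?h4 ?eqxx ?orbT //.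
  rewrite !inE => /or3P[]/eqP->; [exists e0 | exists e2 | exists e4] => //;
  by rewrite AE !inE eqxx ?orbT.
move=> f v0 k lf lt_k3.
have f01 : (e0 \in f) = (e1 \notin f) by rewrite (lf _ e1) // /sib n01 h0 eqxx orbT.
have f12 : (e1 \in f) = (e2 \notin f) by rewrite (lf _ e2) // /sib n12 h1 eqxx.
have f23 : (e2 \in f) = (e3 \notin f) by rewrite (lf _ e3) // /sib n23 h2 eqxx orbT.
have f34 : (e3 \in f) = (e4 \notin f) by rewrite (lf _ e4) // /sib n34 h3 eqxx.
have f45 : (e4 \in f) = (e5 \notin f) by rewrite (lf _ e5) // /sib n45 h4 eqxx orbT.
have [e0f | e0f] := boolP (e0 \in f).
  have f1 : e1 \notin f by rewrite -f01.
  have f2 : e2 \in f by rewrite -[_ \in _]negbK -f12.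
  have f4 : e4 \in f by rewrite -[_ \in _]negbK -f34 -f23 f2.
  by case: k lt_k3 => [|[|[|]]] //= _; rewrite nxtE.
have f1 : e1 \in f by rewrite -[_ \in _]negbK -f01.
have f3 : e3 \in f by rewrite -[_ \in _]negbK -f23 -f12 f1.
have f5 : e5 \in f by rewrite -[_ \in _]negbK -f45 -f34 f3.
case: k lt_k3 => [|[|[|]]] //= _.
- by rewrite -h5 h4 nxtE.
- by rewrite -h1 h0 nxtE.
- by rewrite -h3 h2 nxtE.
Qed.

Lemma switch_local (G : digraph) (f A : {set darc G}) :
  local f -> (forall e e', sib e e' -> (e \in A) = (e' \in A)) ->
  local [set e | (e \in f) (+) (e \in A)].
Proof.
by move=> lf clA x y xy; rewrite !inE (lf _ _ xy) (clA _ _ xy) addNb.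
Qed.

Section Gluings.
Implicit Types (a b : seq nat) (alpha beta : bool) (k : nat).

(* Entry l of a is the start vertex of the second hexagon identified with the end
   vertex l of the first one (3 if there is none), b is the converse; alpha and beta
   select the factor in each hexagon. *)
Definition hop a b alpha beta k :=
  nth 3 b ((nth 3 a ((k + alpha.*2) %% 3) + beta.*2) %% 3).

(** One round through both hexagons, with 3 once the path has left. The guards are essential:
    reduction modulo 3 would turn the marker 3 into a genuine index. *)
Definition pass a b alpha beta k :=
  if (k < 3) && (nth 3 a ((k + alpha.*2) %% 3) < 3) then hop a b alpha beta k else 3.

(** Three rounds decide: a path still inside after them has seen four indices below 3, hence repeats
    and never leaves. *)
Definition acyclic a b alpha beta :=
  all (fun k => 3 <= iter 3 (pass a b alpha beta) k) (iota 0 3).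

Definition gluing a := uniq [seq l <- a | l < 3].

Definition gluings : seq (seq nat) :=
  [seq a <- [seq x :: a | x <- iota 0 4, a <- [seq [:: y; z] | y <- iota 0 4, z <- iota 0 4]]
     | gluing a].

(** Each of [a] and [b] runs over the 34 partial injections between three-element sets, and the
    bounds select 3 or 4 identified vertices. Computation finds an open choice among the four
    factors in every such case. *)
Lemma gluings_acyclic :
  all (fun a => all (fun b => (2 < count (gtn 3) a + count (gtn 3) b < 5) ==>
     has (fun ab => acyclic a b ab.1 ab.2)
       [:: (true, true); (true, false); (false, true); (false, false)]) gluings) gluings.
Proof. by vm_compute. Qed.

End Gluings.

Section TwoHexagons.
Variables (G : digraph) (A B : {set darc G}).
Hypotheses (dd : is_2dd G) (Gclean : clean G).
Hypotheses (AA : A \in ACs G) (BA : B \in ACs G) (AB : A != B).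
Notation K := [set A; B].
Notation X := (sources (cover K)).
Notation Y := (targets (cover K)).

Lemma mem_cover_pair e : (e \in cover K) = (e \in A) || (e \in B).
Proof.
apply/bigcupP/orP => [[C] | [eC | eC]].
- by rewrite !inE => /orP[]/eqP-> eC; [left | right].
- by exists A; rewrite // !inE eqxx.
- by exists B; rewrite // !inE eqxx orbT.
Qed.

Lemma ACs_closed (C : {set darc G}) e e' : C \in ACs G -> sib e e' -> (e \in C) = (e' \in C).
Proof.
move=> /(ACsP (dd_2digraph dd))[x ->] s; apply/idP/idP; rewrite !inE => h.
  exact: connect_trans h (connect1 s).
by apply: connect_trans h (connect1 _); rewrite sib_sym.
Qed.

Lemma ACs_disjoint e : e \in A -> e \in B -> False.
Proof.
have /(ACsP (dd_2digraph dd))[x xA] := AA; have /(ACsP (dd_2digraph dd))[y yB] := BA.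
rewrite xA yB => /ac_of_eq e1 /ac_of_eq e2.
by case/eqP: AB; rewrite xA yB -e1 -e2.
Qed.

Lemma sources_disjoint v : v \in sources A -> v \in sources B -> False.
Proof.
move=> /imsetP[e eA ->]; rewrite mem_sources; first exact: ACs_disjoint.
by move=> ? ?; apply: ACs_closed.
Qed.

Lemma targets_disjoint v : v \in targets A -> v \in targets B -> False.
Proof.
move=> /imsetP[e eA ->]; rewrite mem_targets; first exact: ACs_disjoint.
by move=> ? ?; apply: ACs_closed.
Qed.

Lemma sources_pair v : (v \in X) = (v \in sources A) || (v \in sources B).
Proof.
apply/imsetP/orP => [[e + ->] | [] /imsetP[e eC ->]].
- by rewrite mem_cover_pair => /orP[] eC; [left | right]; apply: imset_f.
- by exists e; rewrite // mem_cover_pair eC.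
- by exists e; rewrite // mem_cover_pair eC orbT.
Qed.

Lemma targets_pair v : (v \in Y) = (v \in targets A) || (v \in targets B).
Proof.
apply/imsetP/orP => [[e + ->] | [] /imsetP[e eC ->]].
- by rewrite mem_cover_pair => /orP[] eC; [left | right]; apply: imset_f.
- by exists e; rewrite // mem_cover_pair eC.
- by exists e; rewrite // mem_cover_pair eC orbT.
Qed.

Lemma clean_sources (C : {set darc G}) v :
  C \in ACs G -> v \in targets C -> v \in sources C = false.
Proof.
move=> CA /imsetP[e eC ->]; apply/negP => /imsetP[e' e'C h].
exact: Gclean CA e' e e'C eC (esym h).
Qed.

Variables (a0 b0 : darc G) (xA yA xB yB : seq (vert G)).
Hypotheses (a0A : a0 \in A) (b0B : b0 \in B).
Hypotheses (xA3 : size xA = 3) (xAu : uniq xA) (xAE : sources A =i xA).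
Hypotheses (yA3 : size yA = 3) (yAu : uniq yA) (yAE : targets A =i yA).
Hypotheses (xB3 : size xB = 3) (xBu : uniq xB) (xBE : sources B =i xB).
Hypotheses (yB3 : size yB = 3) (yBu : uniq yB) (yBE : targets B =i yB).
Hypothesis nxtA : forall f v0 k, local f -> k < 3 ->
  nxt f (nth v0 xA k) = nth v0 yA ((k + (a0 \notin f).*2) %% 3).
Hypothesis nxtB : forall f v0 k, local f -> k < 3 ->
  nxt f (nth v0 xB k) = nth v0 yB ((k + (b0 \notin f).*2) %% 3).

Lemma card_sources : #|X| = 6.
Proof.
have XE : X =i xA ++ xB by move=> v; rewrite mem_cat sources_pair xAE xBE.
rewrite (eq_card XE) (card_uniqP _) ?size_cat ?xA3 ?xB3 // cat_uniq xAu xBu andbT.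
apply/hasPn => v; rewrite -xBE -[_ \in mem xA]/(v \in xA) -xAE => vB; apply/negP => vA.
exact: sources_disjoint vA vB.
Qed.

Let a := [seq index v xB | v <- yA].
Let b := [seq index v xA | v <- yB].

(** By cleanness an end vertex of one hexagon can only coincide with a start vertex of the other
    one, and these coincidences are what [a] and [b] record. *)
Lemma card_saturated : #|X :&: Y| = count (gtn 3) a + count (gtn 3) b.
Proof.
have XYE : X :&: Y =i filter [in xB] yA ++ filter [in xA] yB.
  move=> v; rewrite mem_cat !mem_filter inE sources_pair targets_pair /= -xAE -xBE -yAE -yBE.
  have cA : v \in targets A -> v \in sources A = false by apply: clean_sources.
  have cB : v \in targets B -> v \in sources B = false by apply: clean_sources.
  case: (v \in targets A) cA => [/(_ isT)-> | _];
  case: (v \in targets B) cB => [/(_ isT)-> | _]; rewrite ?andbT ?andbF ?orbF //=.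
rewrite (eq_card XYE) (card_uniqP _).
  rewrite size_cat !size_filter /a /b !count_map; congr (_ + _).
    by apply: eq_count => v /=; rewrite -xB3 index_mem.
  by apply: eq_count => v /=; rewrite -xA3 index_mem.
rewrite cat_uniq !filter_uniq // andbT /=; apply/hasPn => v.
rewrite !mem_filter /= -yBE => /andP[_ vB]; rewrite negb_and -yAE; apply/orP; right.
by apply/negP => vA; apply: targets_disjoint vA vB.
Qed.

Lemma gluing_index (xs ys : seq (vert G)) : size xs = 3 -> size ys = 3 -> uniq ys ->
  [seq index v xs | v <- ys] \in gluings.
Proof.
move=> xs3 ys3 uys; rewrite mem_filter; apply/andP; split.
  rewrite /gluing filter_map map_inj_in_uniq ?filter_uniq // => u v.
  rewrite !mem_filter /= -xs3 !index_mem => /andP[ux _] /andP[vx _] e.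
  by rewrite -(nth_index u ux) e nth_index.
have lt4 v : index v xs \in iota 0 4 by rewrite mem_iota /= add0n ltnS -xs3 index_size.
case: ys ys3 {uys} => [|u [|v [|w []]]] // _.
apply/allpairsPdep; exists (index u xs), [:: index v xs; index w xs]; split=> //.
by apply/allpairsPdep; exists (index v xs), (index w xs).
Qed.

(** An arbitrary factor is switched on each hexagon to match the choice found by the finite check;
    the computed rounds are then translated back into iterates of the successor map. *)
Lemma exists_leaves : 2 < #|X :&: Y| < 5 -> exists f, local f /\ leaves X (nxt f).
Proof.
rewrite card_saturated => s_bounds.
have aP : a \in gluings by apply: gluing_index.
have bP : b \in gluings by apply: gluing_index.
have /hasP[[alpha beta] _ /=] := implyP (allP (allP gluings_acyclic _ aP) _ bP) s_bounds.
move=> acyc; have [f0 lf0] := exists_local (dd_2digraph dd).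
have switch (f C : {set darc G}) (c0 : darc G) (gamma : bool) :
    local f -> C \in ACs G -> c0 \in C ->
    exists f', [/\ local f', (c0 \notin f') = gamma
      & forall e, e \notin C -> (e \in f') = (e \in f)].
  move=> lf CA cC; have [cg | cg] := eqVneq (c0 \notin f) gamma; first by exists f.
  exists [set e | (e \in f) (+) (e \in C)]; split.
  - by apply: switch_local => // e e'; apply: ACs_closed.
  - by rewrite inE cC addbT negbK; move: cg; case: (c0 \in f); case: gamma {acyc}.
  - by move=> e eC; rewrite inE (negPf eC) addbF.
have [f1 [lf1 f1a _]] := switch _ _ _ alpha lf0 AA a0A.
have [f [lf fb f_f1]] := switch _ _ _ beta lf1 BA b0B.
have fa : (a0 \notin f) = alpha.
  by rewrite f_f1 ?f1a //; apply/negP => /(ACs_disjoint a0A).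
exists f; split=> // v.
pose p := nxt f; pose v0 := v.
have idx u (xs : seq (vert G)) : size xs = 3 -> (index u xs < 3) = (u \in xs).
  by move=> <-; apply: index_mem.
have nthA k : k < 3 -> nth v0 yA k \notin sources A.
  by move=> lt_k; rewrite clean_sources // yAE mem_nth ?yA3.
have nthB k : k < 3 -> nth v0 yB k \notin sources B.
  by move=> lt_k; rewrite clean_sources // yBE mem_nth ?yB3.
have bstep m : m < 3 -> let k' := nth 3 b ((m + beta.*2) %% 3) in
    if k' < 3 then p (nth v0 xB m) = nth v0 xA k' else p (nth v0 xB m) \notin X.
  move=> lt_m /=; have lt3 : (m + beta.*2) %% 3 < 3 by rewrite ltn_mod.
  rewrite /p nxtB // fb /b (nth_map v0) ?yB3 // idx //.
  case: ifP => [kA | kA]; first by rewrite nth_index.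
  by rewrite sources_pair (negPf (nthB _ lt3)) orbF xAE kA.
(* One [pass] corresponds to two steps of [p], one in each hexagon; the path may leave after the
   first of them or after the second. *)
have astep k : k < 3 -> let k' := pass a b alpha beta k in
    if k' < 3 then iter 2 p (nth v0 xA k) = nth v0 xA k'
    else exists n, iter n p (nth v0 xA k) \notin X.
  move=> lt_k /=; have lt3 : (k + alpha.*2) %% 3 < 3 by rewrite ltn_mod.
  have pk : p (nth v0 xA k) = nth v0 yA ((k + alpha.*2) %% 3) by rewrite /p nxtA // fa.
  rewrite /pass lt_k /= /hop /a (nth_map v0) ?yA3 // idx //.
  case: (boolP (_ \in xB)) => [kB | kB] /=; last first.
    by exists 1; rewrite /= pk sources_pair (negPf (nthA _ lt3)) /= xBE.
  have lt_m : index (nth v0 yA ((k + alpha.*2) %% 3)) xB < 3 by rewrite idx.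
  have := bstep _ lt_m; rewrite /= nth_index // -pk; case: ifP => // _ notX.
  by exists 2.
have Aout n k : k < 3 -> 3 <= iter n (pass a b alpha beta) k ->
    exists m, iter m p (nth v0 xA k) \notin X.
  elim: n k => [|n IHn] k lt_k; first by rewrite /= leqNgt lt_k.
  rewrite iterSr; have := astep k lt_k; rewrite /=.
  case: ifP => [lt_k' e /(IHn _ lt_k')[m mX] | _ //].
  by exists (m + 2); rewrite iterD /= e.
have Aleave k : k < 3 -> exists m, iter m p (nth v0 xA k) \notin X.
  move=> lt_k; apply: (Aout 3) => //; apply: (allP acyc).
  by rewrite mem_iota add0n.
have [vX | vX] := boolP (v \in X); last by exists 0.
move: vX; rewrite sources_pair xAE xBE => /orP[vA | vB].
  rewrite -(nth_index v0 vA); apply: Aleave.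
  by rewrite idx.
have lt_m : index v xB < 3 by rewrite idx.
have := bstep _ lt_m; rewrite /= nth_index //; case: ifP => [lt_k e | _ notX]; last by exists 1.
by have [m mX] := Aleave _ lt_k; exists m.+1; rewrite -/p iterSr e.
Qed.

End TwoHexagons.

(** * Subgraphs with a small boundary *)

Lemma uadj_sym (G : digraph) : symmetric (@uadj G).
Proof. by move=> x y; apply: eq_existsb => e; rewrite orbC. Qed.

Lemma uadj_closed (G : digraph) (a : pred (vert G)) :
  (forall e : darc G, a (src e) = a (tgt e)) -> closed (@uadj G) a.
Proof.
move=> aP x y /existsP[e]; rewrite !unfold_in.
by case/orP=> /andP[/eqP<- /eqP<-]; rewrite aP.
Qed.

Section Boundary.
Variables (G : digraph) (dd : is_2dd G) (K : {set {set darc G}}).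
Hypotheses (KA : K \subset ACs G) (Gconn : connected G).
Notation D := (cover K).
Notation X := (sources D).
Notation Y := (targets D).

Lemma card_saturated_subgraph :
  #|[set v : vert (subgraph K) | is_saturated v]| = #|X :&: Y|.
Proof.
rewrite -(card_imset _ val_inj); apply: eq_card => v; apply/imsetP/idP.
  by case=> w + ->; rewrite inE is_saturated_induced //; apply: cover_closed.
move=> vXY; have vF : v \in endpoints D.
  by rewrite mem_endpoints; move: vXY; rewrite inE => /andP[->].
exists (Sub v vF) => //; rewrite inE is_saturated_induced //.
exact: cover_closed.
Qed.

(** Every arc has its start in [X] exactly when its end is in [Y], and away from [x] and [y] the two
    sets agree. After the split, [side] is therefore constant on components and separates the two
    out-copies. *)
Lemma boundary_two_splittable x y :
  X :\: Y = [set x] -> Y :\: X = [set y] -> two_splittable G.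
Proof.
move=> XYx YXy.
have: x \in X :\: Y by rewrite XYx set11.
rewrite inE => /andP[xY xX].
have: y \in Y :\: X by rewrite YXy set11.
rewrite inE => /andP[yX yY].
have nxy : x != y by apply: contraNneq yX => <-.
exists [set x; y]; split; [by rewrite cards2 nxy | by move=> v _; apply: dd|].
have symG : connect_sym (@uadj G) := sym_connect_sym (@uadj_sym G).
have -> : num_components G = 1.
  rewrite -(n_comp_connect symG x); apply: eq_n_comp_r => v.
  by rewrite !unfold_in; apply/esym/Gconn.
set S := split_vertices _; have symS := sym_connect_sym (@uadj_sym S).
pose side (v : vert S) := match v with inl v => v \in X | inr w => val w \in Y end.
have side_cl : closed (@uadj S) side.
  apply: uadj_closed => e /=; rewrite mem_cover_src //.
  case: insubP => [w _ wE | ]; first by rewrite /= -[sval w]/(val w) wE mem_cover_tgt.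
  rewrite !inE negb_or => /andP[nx ny] /=; rewrite -(mem_cover_tgt dd KA).
  have := in_set1 (@tgt G e) x; rewrite -XYx inE (negPf nx).
  have := in_set1 (@tgt G e) y; rewrite -YXy inE (negPf ny).
  by case: (_ \in X); case: (_ \in Y).
have nconn : ~~ connect (@uadj S) (inl x) (inl y).
  apply/negP => /(closed_connect side_cl).
  by rewrite -[LHS]/(x \in X) -[RHS]/(y \in X) xX (negPf yX).
apply/card_gt1P; exists (root (@uadj S) (inl x)), (root (@uadj S) (inl y)).
by rewrite !inE !(roots_root symS) (root_connect symS) nconn.
Qed.

(** Without boundary [X] equals [Y], so membership is constant along arcs, and connectedness makes
    it universal. *)
Lemma boundary_empty : #|X :\: Y| = 0 -> 0 < #|X| -> forall v, v \in X :&: Y.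
Proof.
move=> XY0 X0; have YX0 : #|Y :\: X| = 0 by rewrite -(card_entry_exit dd KA).
have eqXY : X = Y.
  apply/eqP; rewrite eqEsubset -!setD_eq0 -!cards_eq0 XY0 YX0 //.
have /card_gt0P[x xX] := X0; move=> v; rewrite -eqXY setIid.
have cl : closed (@uadj G) [in X].
  apply: uadj_closed => e; rewrite /= mem_cover_src //.
  by rewrite eqXY mem_cover_tgt.
by have := closed_connect cl (Gconn x v); rewrite xX => <-.
Qed.

End Boundary.

Definition turn (b : bool) : 'I_3 -> 'I_3 := if b then @ordS 3 else @ord_pred 3.

Lemma turn_bij b : bijective (turn b).
Proof.
case: b; first by exists (@ord_pred 3); [apply: ordSK | apply: ord_predK].
by exists (@ordS 3); [apply: ord_predK | apply: ordSK].
Qed.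

Lemma turn_neq i : turn true i != turn false i.
Proof. by case: i => -[|[|[|]]]. Qed.

Lemma turn_connect b i j : fconnect (turn b) i j.
Proof.
have inj := bij_inj (turn_bij b).
have conn k : fconnect (turn b) ord0 k.
  have [n <-] : exists n, iter n (turn b) ord0 = k; last exact: fconnect_iter.
  case: k => -[|[|[|]]] // lt_k; [exists 0 | exists (if b then 1 else 2) |
    exists (if b then 2 else 1)]; by case: b {inj}; apply: val_inj.
by apply: connect_trans (conn j); rewrite fconnect_sym.
Qed.

(** The start and end vertices are the same three vertices; the two factors are the two orientations
    of a directed triangle. *)
Definition triangle : digraph := hexagon (@id 'I_3) (@id 'I_3) turn.

Section Triangle.
Variables (G : digraph) (dd : is_2dd G) (K : {set {set darc G}}).
Hypotheses (KA : K \subset ACs G) (full : forall v, v \in sources (cover K) :&: targets (cover K)).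

Lemma id_cover (t : 'I_3) : (t \in codom id) || (t \in codom id).
Proof. by rewrite orbb; apply/codomP; exists t. Qed.

Let T2 : is_2digraph triangle :=
  @hexagon_2digraph _ _ _ _ _ turn (@inj_id _) (@inj_id _) id_cover turn_bij.

Lemma triangle_saturated (t : vert triangle) : indeg t = 2 /\ outdeg t = 2.
Proof.
have tc : t \in codom (@id 'I_3) by apply/codomP; exists t.
rewrite (@hexagon_outdeg _ _ _ _ id turn (@inj_id _)) tc.
by rewrite (@hexagon_indeg _ _ _ id _ turn (@inj_id _) turn_bij) tc.
Qed.

Lemma no_entry_triangle (u : entry triangle) : False.
Proof. by case: u => t /andP[]; have [-> _] := triangle_saturated t. Qed.

Lemma no_exit_triangle (u : exit triangle) : False.
Proof. by case: u => t /andP[_]; have [_ ->] := triangle_saturated t. Qed.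

Lemma no_complement_vert (x : vert (complement K)) : False.
Proof. by have := valP x; rewrite complement_vert // full. Qed.

(** The complement has no vertices and the triangle no entry or exit, so both bijections are between
    empty types. All factors of the result are single cycles, which makes it odd and Hamiltonian. *)
Lemma triangle_replacement : odd_2dd G -> all_ACs_size6 G -> hamiltonian G ->
  replaceable K.
Proof.
move=> Godd G6 Gham.
pose phi (u : exit (complement K)) : entry triangle := False_rect _ (no_complement_vert (val u)).
pose psi (u : exit triangle) : entry (complement K) := False_rect _ (no_exit_triangle u).
have phi_bij : bijective phi.
  exists (fun u => False_rect _ (no_entry_triangle u)) => u.
    by case: (no_complement_vert (val u)).
  by case: (no_entry_triangle u).
have psi_bij : bijective psi.
  exists (fun u => False_rect _ (no_complement_vert (val u))) => u.
    by case: (no_exit_triangle u).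
  by case: (no_complement_vert (val u)).
have dd' : is_2dd (replace phi psi) := replace_2dd phi_bij psi_bij dd T2.
pose class i := glue_class (replace_rel phi psi) (inr i).
have classP v : exists i, v = class i.
  rewrite -(glue_classK v); case: (val v) => [x | i]; last by exists i.
  by case: (no_complement_vert x).
have one h : @local (replace phi psi) h -> fcard (nxt h) (vert (replace phi psi)) = 1.
  move=> lh; have /(local_replace phi_bij psi_bij)/local_union[_ lh2] := lh.
  have [b hb] := @hexagon_localE _ _ _ id id turn (@inj_id _) (@inj_id _) turn_bij
    (card_ord 3) turn_neq _ lh2.
  have step i : nxt h (class i) = class (turn b i).
    have bih : (inr (b, i) : darc (replace phi psi)) \in h.
      by have := hb (b, i); rewrite inE eqxx.
    exact: (nxtE lh bih).
  apply/(fcard1P (nxt_inj dd' lh)); split; first by exists (class ord0).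
  move=> u v; have [i ->] := classP u; have [j ->] := classP v.
  have /iter_findex <- := turn_connect b i j.
  elim: (findex _ _ _) => [|n IHn]; first exact: connect0.
  by rewrite iterS -step; apply: connect_trans IHn (fconnect1 _ _).
exists triangle, phi, psi; split=> //.
- exact: (@hexagon_single_AC _ _ _ id id turn (@inj_id _) (@inj_id _) id_cover turn_bij
    (card_ord 3) turn_neq).
- rewrite eq_card0; last by move=> u; case: (no_exit_triangle u).
  rewrite card_exit_subgraph // (_ : _ :\: _ = set0) ?cards0 //.
  by apply/setP => v; have := full v; rewrite !inE => /andP[->].
split.
- split=> // h /(factor_local (dd_2digraph dd')) lh.
  by rewrite (num_cyclesE dd' lh) one.
- apply: (replace_size6 phi_bij psi_bij dd T2 G6) => e.
  exact: (@card_hexagon_ac_of _ _ _ id id turn (@inj_id _) (@inj_id _) turn_bij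
    (card_ord 3) turn_neq).
split=> _ //; have [h lh] := exists_local (dd_2digraph dd').
apply/(hamiltonianE dd'); first by apply/card_gt0P; exists (class ord0).
by exists h; split=> //; apply: one.
Qed.

End Triangle.

(** Every factor alternates between the start vertices of [A] and of [B], so its cycles all meet the
    three in [A], and it has one or three cycles. A factor and its switch on [A] cannot both have
    three. *)
Lemma hamiltonian_two_hexagons (G : digraph) (A B : {set darc G}) :
  odd_2dd G -> clean G -> all_ACs_size6 G -> A \in ACs G -> B \in ACs G -> A != B ->
  (forall v, v \in sources (cover [set A; B]) :&: targets (cover [set A; B])) ->
  hamiltonian G.
Proof.
move=> Godd Gclean G6 AA BA AB full; have dd := Godd.1.
have fullX v : v \in sources A \/ v \in sources B.
  by have := full v; rewrite inE sources_pair // => /andP[/orP].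
have fullY v : v \in targets A \/ v \in targets B.
  by have := full v; rewrite inE targets_pair // => /andP[_ /orP].
have [a [xs [ys [aA [xs3 xsu xsE] [ys3 ysu ysE] nxtA]]]] := ac_coordinates dd AA (G6 _ AA).
have nsrc (C : {set darc G}) v : C \in ACs G -> v \in targets C -> v \in sources C = false.
  exact: clean_sources.
have nxt_mem (C : {set darc G}) f v : C \in ACs G -> local f ->
    v \in sources C -> nxt f v \in targets C.
  move=> CA lf /imsetP[e eC ->]; have [e' e'f h] := local_out dd (src e) lf.
  rewrite -h nxtE //; apply: imset_f; have [-> // | ne] := eqVneq e' e.
  by rewrite -(ACs_closed dd CA (e := e)) // /sib eq_sym ne h eqxx.
have AtoB f v : local f -> v \in sources A -> nxt f v \in sources B.
  move=> lf vA; have nA := nsrc _ _ AA (nxt_mem _ _ _ AA lf vA).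
  by case: (fullX (nxt f v)) => //; rewrite nA.
have BtoA f v : local f -> v \in sources B -> nxt f v \in sources A.
  move=> lf vB; have nB := nsrc _ _ BA (nxt_mem _ _ _ BA lf vB).
  by case: (fullX (nxt f v)) => //; rewrite nB.
have Z3 : #|sources A| = 3 by rewrite (eq_card xsE) (card_uniqP xsu).
have meet f : local f -> forall v, exists2 z, z \in sources A & fconnect (nxt f) v z.
  move=> lf v; case: (fullX v) => [vA | vB]; first by exists v; rewrite ?connect0.
  by exists (nxt f v); [apply: BtoA | apply: fconnect1].
have [f lf] := exists_local (dd_2digraph dd).
pose g : {set darc G} := [set e | (e \in f) (+) (e \in A)].
have lg : local g by apply: switch_local => // e e'; apply: ACs_closed.
have G0 : 0 < #|vert G| by apply/card_gt0P; exists (src a).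
have dichotomy h (lh : local h) :=
  fcard_meet3 (nxt_inj dd lh) Z3 (meet h lh) (odd_fcard Godd lh).
apply/(hamiltonianE dd G0); case: (dichotomy f lf) => [f1 | df]; first by exists f.
case: (dichotomy g lg) => [g1 | dg]; first by exists g.
(* With three cycles each contains one start vertex of [A], hence has length two. *)
have ret h v : local h ->
    {in sources A &, forall x y, fconnect (nxt h) x y -> x = y} ->
    v \in sources A -> nxt h (nxt h v) = v.
  move=> lh dh vA; apply/esym/dh => //; first exact/BtoA/AtoB.
  exact: (fconnect_iter (nxt h) 2 v).
have fgB v : v \in sources B -> nxt f v = nxt g v.
  move=> vB; have [e eg ev] := local_out dd v lg.
  have eB : e \in B.
    by rewrite -(mem_sources (D := B)) ?ev // => x y; apply: ACs_closed.
  have eA : e \notin A by apply/negP => eA; apply: (ACs_disjoint dd AA BA AB eA eB).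
  have ef : e \in f by move: eg; rewrite inE (negPf eA) addbF.
  by rewrite -ev !nxtE.
pose v := nth (src a) xs 0.
have vA : v \in sources A by rewrite xsE mem_nth ?xs3.
(* Both values are the predecessor of [v] under [nxt f], because [f] and [g] agree on [B]. But on
   [A] they use opposite arcs, so their indices in [ys] differ. *)
have: nxt f v = nxt g v.
  apply: (nxt_inj dd lf); rewrite ret // fgB ?ret //.
  exact: AtoB.
have ag : (a \notin g) = (a \in f) by rewrite inE aA addbT negbK.
rewrite !nxtA // ag => /eqP; rewrite nth_uniq ?ys3 ?ltn_mod //.
by case: (a \in f).
Qed.

(** * Unique or distinct open routes, and the theorem *)

Lemma unique_routeP (G : digraph) (K : {set {set darc G}}) (f : {set darc G})
    (X := sources (cover K)) (Y := targets (cover K)) :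
  is_2dd G -> K \subset ACs G -> local f -> leaves X (nxt f) ->
  (forall g, local g -> leaves X (nxt g) ->
     {in X :\: Y, leave X (nxt g) =1 leave X (nxt f)}) ->
  exists r : {ffun entry (subgraph K) -> exit (subgraph K)}, unique_open_route r.
Proof.
move=> dd KA lf lvf uniq_f; have [r rP] := exists_route dd KA lf lvf.
exists r; split; first by apply/open_routeE => //; exists f.
move=> r' /(open_routeE dd KA)[g [lg og r'P]].
apply/ffunP => u; apply/val_inj/val_inj; rewrite r'P rP; apply: uniq_f => //.
by have := valP u; rewrite is_entry_induced //; apply: cover_closed.
Qed.

(** The case distinction is constructive: both properties of [g] are decidable on finite types, so a
    counterexample can be searched for. *)
Lemma open_route_alternative (G : digraph) (X Y : {set vert G}) (f : {set darc G}) :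
  (forall g, local g -> leaves X (nxt g) ->
     {in X :\: Y, leave X (nxt g) =1 leave X (nxt f)}) \/
  exists g u, [/\ local g, leaves X (nxt g), u \in X :\: Y
    & leave X (nxt g) u != leave X (nxt f) u].
Proof.
pose localb (g : {set darc G}) :=
  [forall e, forall e', sib e e' ==> ((e \in g) == (e' \notin g))].
pose leavesb (g : {set darc G}) :=
  [forall v, exists y, fconnect (nxt g) v y && (y \notin X)].
have localP g : reflect (local g) (localb g).
  apply: (iffP forallP) => h e; last by apply/forallP => e'; apply/implyP => /h ->.
  by move=> e' s; apply/eqP/(implyP (forallP (h e) e')).
have leavesP g : reflect (leaves X (nxt g)) (leavesb g).
  apply: (iffP forallP) => h v.
    by have /existsP[y /andP[/iter_findex vy yX]] := h v; exists (findex (nxt g) v y); rewrite vy.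
  by have [n nX] := h v; apply/existsP; exists (iter n (nxt g) v); rewrite fconnect_iter.
pose bad gu := [&& localb gu.1, leavesb gu.1, gu.2 \in X :\: Y
                 & leave X (nxt gu.1) gu.2 != leave X (nxt f) gu.2].
have [[g u] /and4P[/localP lg /leavesP og uXY neq] | none] := pickP bad.
  by right; exists g, u.
left=> g /localP lg /leavesP og u uXY; apply/eqP; apply: contraFT (none (g, u)) => neq.
by rewrite /bad lg og uXY.
Qed.

Theorem proposition13 (G : digraph) (K : {set {set darc G}}) (s : nat)
    (G_2dd : is_2dd G) (G_clean : clean G) (G_six : all_ACs_size6 G)
    (G_odd : odd_2dd G) (G_conn : connected G) (G_nsplit : ~ two_splittable G)
    (K_sub : K \subset ACs G) (K_two : #|K| = 2)
    (F_sat : #|[set v : vert (subgraph K) | is_saturated v]| = s)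
    (s_gt2 : 2 < s) :
  exists G' : digraph,
    [/\ (exists r : {ffun entry (subgraph K) -> exit (subgraph K)},
           unique_open_route r /\ G' = collapse r)
        \/
        (exists (F' : digraph)
                (phi : exit (complement K) -> entry F')
                (psi : exit F' -> entry (complement K)),
           [/\ single_AC F', #|exit F'| = #|exit (subgraph K)|,
               bijective phi, bijective psi & G' = replace phi psi]),
        odd_2dd G', all_ACs_size6 G' & H_equivalent G G'].
Proof.
have /eqP/cards2P[A [B [AB KE]]] := K_two.
have AA : A \in ACs G by apply: (subsetP K_sub); rewrite KE set21.
have BA : B \in ACs G by apply: (subsetP K_sub); rewrite KE set22.
have [a [xA [yA [aA [xA3 xAu xAE] [yA3 yAu yAE] nxtA]]]] :=
  ac_coordinates G_2dd AA (G_six _ AA).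
have [b [xB [yB [bB [xB3 xBu xBE] [yB3 yBu yBE] nxtB]]]] :=
  ac_coordinates G_2dd BA (G_six _ BA).
pose X := sources (cover K); pose Y := targets (cover K).
have X6 : #|X| = 6.
  by rewrite /X KE; apply: (card_sources G_2dd AA BA AB xA3 xAu xAE xB3 xBu xBE).
have sE : s = #|X :&: Y| by rewrite -F_sat card_saturated_subgraph.
have XYs : #|X :\: Y| = 6 - s by rewrite cardsD -sE X6.
have YX : #|Y :\: X| = #|X :\: Y| by rewrite [RHS]card_entry_exit.
have s_le6 : s <= 6 by rewrite sE -X6 subset_leq_card // subsetIl.
suff [[r [r_uniq [G'odd G'6 G'H]]] | [F' [phi [psi [F'1 F'c bphi bpsi [G'odd G'6 G'H]]]]]] :
    (exists r : {ffun entry (subgraph K) -> exit (subgraph K)}, unique_open_route r /\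
       [/\ odd_2dd (collapse r), all_ACs_size6 (collapse r) & H_equivalent G (collapse r)])
    \/ replaceable K.
- by exists (collapse r); split=> //; left; exists r.
- by exists (replace phi psi); split=> //; right; exists F', phi, psi.
have [s6 | s_neq6] := eqVneq s 6.
  have full : forall v, v \in X :&: Y.
    by apply: boundary_empty => //; rewrite ?X6 // -/X -/Y XYs s6.
  right; apply: triangle_replacement => //.
  by apply: (hamiltonian_two_hexagons G_odd G_clean G_six AA BA AB); rewrite -KE.
have [s5 | s_neq5] := eqVneq s 5.
  have /eqP/cards1P[x XYx] : #|X :\: Y| = 1 by rewrite XYs s5.
  have /eqP/cards1P[y YXy] : #|Y :\: X| = 1 by rewrite YX XYs s5.
  by case: G_nsplit; apply: boundary_two_splittable XYx YXy.
have s_bounds : 2 < s < 5 by move: s_gt2 s_le6 s_neq5 s_neq6; clear; lia.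
have [f [lf lvf]] : exists f, local f /\ leaves X (nxt f).
  rewrite /X KE; apply: (exists_leaves G_2dd G_clean AA BA AB aA bB xA3 xAE yA3 yAu yAE
    xB3 xBE yB3 yBu yBE nxtA nxtB).
  by rewrite -KE -sE.
case: (open_route_alternative X Y f) => [uniq_f | [g [u [lg og uXY neq]]]].
  have [r ru] := unique_routeP G_2dd K_sub lf lvf uniq_f; left; exists r; split=> //.
  apply: collapse_correct => //.
  have /card_gt0P[v] : 0 < #|Y :\: X|.
    by rewrite YX XYs subn_gt0; move: s_bounds; clear; lia.
  by rewrite inE => /andP[vX _]; exists v.
have no_swap := open_route_no_swap K_sub G_odd lf lg lvf og.
(* With two entries, distinct routes could differ only by a transposition of [u] and the other entry
   [t]. *)
have [s4 | s_neq4] := eqVneq s 4.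
  have /eqP/cards1P[t tE] : #|(X :\: Y) :\ u| = 1.
    by have := cardsD1 u (X :\: Y); rewrite uXY XYs s4; clear; lia.
  have : t \in (X :\: Y) :\ u by rewrite tE set11.
  rewrite in_setD1 => /andP[tu tXY].
  case/eqP: neq; rewrite (no_swap u t) // 1?eq_sym // => w wXY wu wt.
  have : w \in (X :\: Y) :\ u by rewrite in_setD1 wu.
  by rewrite tE inE (negPf wt).
have s3 : s = 3 by move: s_bounds s_neq4; clear; lia.
right; apply: (@hexagon_replacement G K (fun b => if b then f else g)) => //.
- by rewrite -/X -/Y XYs s3.
- by case.
- by case.
(* If the routes agreed at one entry [w], only two entries [u] and [t] would remain, and the routes
   could differ only by their transposition. *)
move=> w wXY; apply: contra_neq neq => /= fgw.
have [-> // | wu] := eqVneq u w.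
have /eqP/cards1P[t tE] : #|((X :\: Y) :\ u) :\ w| = 1.
  have := cardsD1 u (X :\: Y); rewrite uXY XYs s3.
  have := cardsD1 w ((X :\: Y) :\ u); rewrite in_setD1 eq_sym wu wXY.
  by clear; lia.
have : t \in ((X :\: Y) :\ u) :\ w by rewrite tE set11.
rewrite !in_setD1 => /and3P[tw tu tXY].
apply/esym/(no_swap u t) => //; first by rewrite eq_sym.
move=> z zXY zu zt; have [-> // | zw] := eqVneq z w.
have : z \in ((X :\: Y) :\ u) :\ w by rewrite !in_setD1 zw zu.
by rewrite tE inE (negPf zt).
Qed.
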